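(* Let $\gamma\in\mathbb{Z}/m\mathbb{Z}$ and $H_\gamma=\mathbb{Z}/p\mathbb{Z}\rtimes\mathbb{Z}/m_\gamma\mathbb{Z}$. The $\mathbf{v}$-function $\mathbf{v}_{V_{d,s},\gamma}:\Delta_{G,\gamma}\to\frac{1}{|H_\gamma|}\mathbb{Z}$ associated to the indecomposable representation $V_{d,s}$ of $G=\mathbb{Z}/p\mathbb{Z}\rtimes\mathbb{Z}/m\mathbb{Z}$ is given by $$\mathbf{v}_{V_{d,s},\gamma}(x)=\begin{cases}0&x\text{ is trivial},\\ \displaystyle\sum_{(i,j)\in I_{\gamma,r,s}}\frac{i}{m_\gamma}+\sum_{(i,j)\in I_{\gamma,r,s}}\left\lceil\frac{-iv_E(\alpha_\gamma)-jv_E(\beta)}{m_\gamma p}\right\rceil&\text{otherwise},\end{cases}$$ where $x$ corresponds to the algebra $L\cong E^{\gcd(\gamma,m)}$ with ramification jump $r$ and $$I_{\gamma,r,s}=\{(i,j)\in\{0,\dots,m_\gamma-1\}\times\{0,\dots,d-1\}:i-rj\equiv s(\gamma^\dagger)^{-1}\pmod{m_\gamma}\}.$$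
   Context: $k$ is algebraically closed of characteristic $p>0$, $K=k((t))$, $p\nmid m$; fixed primitive roots of unity $\zeta_n\in k$ ($p\nmid n$) with $\zeta_{m'n}^n=\zeta_{m'}$. $G=\langle\sigma\rangle\rtimes\langle\tau\rangle$, $\sigma^p=\tau^m=1$, $\tau\sigma\tau^{-1}=\sigma^{a(G)}$. $m_\gamma=m/\gcd(\gamma,m)$, $\gamma^\dagger=\gamma/\gcd(\gamma,m)\in(\mathbb{Z}/m_\gamma\mathbb{Z})^\times$ (for $\gamma=0$, $m_\gamma=1$); $H_\gamma\subset G$ is generated by $\sigma$ and $\tau_\gamma=\tau^{\gcd(\gamma,m)}$. $\Delta_{G,\gamma}$ is the space of $G$-torsors over $\operatorname{Spec}K$ corresponding to $G$-étale $K$-algebras $L\cong E^{\gcd(\gamma,m)}$ with $E/K$ an $H_\gamma$-extension, $E=K(\alpha_\gamma,\beta)$, $\alpha_\gamma=t^{1/m_\gamma}$, $\beta$ an Artin–Schreier generator over $K(\alpha_\gamma)$, $\sigma(\alpha_\gamma)=\alpha_\gamma$, $\sigma(\beta)=\beta+1$, $\tau_\gamma(\alpha_\gamma)=\zeta_{m_\gamma}^{\gamma^\dagger}\alpha_\gamma$, $\tau_\gamma(\beta)=\zeta_{m_\gamma}^{-\gamma^\dagger r}\beta$, where $r$ is the lower ramification jump of $E/K$ ($v_E(\sigma(\pi)-\pi)=r+1$, $\pi$ a uniformiser, $v_E$ the normalised valuation of $E$), and $\beta$ is chosen with $v_E(\beta)=-r$; $v_E(\alpha_\gamma)=p$. For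 $1\le d\le p$, $s\in\mathbb{Z}/m\mathbb{Z}$, $V_{d,s}$ is the indecomposable representation with coordinates $x_1,\dots,x_d$, $\sigma(x_i)=x_i+x_{i+1}$ ($i<d$), $\sigma(x_d)=x_d$, $\tau(x_1)=\zeta_m^sx_1$. For a $G$-étale $K$-algebra $M$ with integral closure $\mathcal{O}_M$ of $\mathcal{O}_K=k[[t]]$, $\Xi_M\subset\mathcal{O}_M^{\oplus d}$ is the set of $(c_i)$ such that $x_i\mapsto c_i$ is $G$-equivariant, and $\mathbf{v}_V(M)=\frac1{\#G}\operatorname{length}_{\mathcal{O}_K}\mathcal{O}_M^{\oplus d}/(\mathcal{O}_M\Xi_M)$; $\mathbf{v}_{V,\gamma}$ is its restriction to $\Delta_{G,\gamma}$. *)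

(* Defs.v *)
From HB Require Import structures.
From mathcomp Require Import all_boot all_order all_algebra all_fingroup.
From mathcomp Require Import all_field all_character.
From mathcomp Require Import boolp classical_sets.
Set Implicit Arguments.
Unset Strict Implicit.
Unset Printing Implicit Defensive.
Import Order.TTheory GRing.Theory Num.Theory.
Local Open Scope ring_scope.

Record fps (k : Type) := Fps { fcoef : nat -> k }.

HB.instance Definition _ (k : Type) := gen_eqMixin (fps k).
HB.instance Definition _ (k : Type) := gen_choiceMixin (fps k).

Lemma fpsP (k : Type) (f g : fps k) :
  (forall n, fcoef f n = fcoef g n) -> f = g.
Proof. by case: f g => [f] [g] /= fg; congr Fps; apply/funext. Qed.

Section FpsRing.
Variable k : fieldType.
Implicit Types f g h : fps k.

Definition fps_zero : fps k := Fps (fun=> 0).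
Definition fps_opp f : fps k := Fps (fun n => - fcoef f n).
Definition fps_add f g : fps k := Fps (fun n => fcoef f n + fcoef g n).
Definition fpsC (c : k) : fps k := Fps (fun n => c *+ (n == 0)%N).
Definition fpsX : fps k := Fps (fun n => (n == 1)%:R).
Definition fps_mul f g : fps k :=
  Fps (fun n => \sum_(i < n.+1) fcoef f i * fcoef g (n - i)).

Fact fps_addA : associative fps_add.
Proof. by move=> f g h; apply: fpsP => n /=; rewrite addrA. Qed.
Fact fps_addC : commutative fps_add.
Proof. by move=> f g; apply: fpsP => n /=; rewrite addrC. Qed.
Fact fps_add0 : left_id fps_zero fps_add.
Proof. by move=> f; apply: fpsP => n /=; rewrite add0r. Qed.
Fact fps_addN : left_inverse fps_zero fps_opp fps_add.
Proof. by move=> f; apply: fpsP => n /=; rewrite addNr. Qed.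

HB.instance Definition _ :=
  GRing.isZmodule.Build (fps k) fps_addA fps_addC fps_add0 fps_addN.

Definition fps_trunc N f : {poly k} := \poly_(i < N) fcoef f i.

Lemma fps_mul_trunc N f g n : (n < N)%N ->
  fcoef (fps_mul f g) n = (fps_trunc N f * fps_trunc N g)`_n.
Proof.
move=> nN; rewrite coefM /=; apply: eq_bigr => i _.
have iN : (i < N)%N by apply: leq_ltn_trans nN; rewrite -ltnS.
by rewrite !coef_poly iN (leq_ltn_trans (leq_subr i n) nN).
Qed.

Lemma coefM_eq (p q p' q' : {poly k}) n :
    (forall i, (i <= n)%N -> p`_i = p'`_i) ->
    (forall i, (i <= n)%N -> q`_i = q'`_i) ->
  (p * q)`_n = (p' * q')`_n.
Proof.
move=> pp' qq'; rewrite !coefM; apply: eq_bigr => i _.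
by rewrite pp' -1?ltnS // qq' // leq_subr.
Qed.

Lemma fps_trunc_mul N f g n : (n < N)%N ->
  (fps_trunc N (fps_mul f g))`_n = (fps_trunc N f * fps_trunc N g)`_n.
Proof. by move=> nN; rewrite coef_poly nN; apply: fps_mul_trunc. Qed.

Fact fps_mulA : associative fps_mul.
Proof.
move=> f g h; apply: fpsP => n; rewrite !(fps_mul_trunc _ _ (ltnSn n)) //.
rewrite (@coefM_eq _ _ (fps_trunc n.+1 f)
  (fps_trunc n.+1 g * fps_trunc n.+1 h)) //; last first.
  by move=> i; rewrite -ltnS => iN; rewrite fps_trunc_mul.
rewrite mulrA; apply: coefM_eq => // i.
by rewrite -ltnS => iN; rewrite fps_trunc_mul.
Qed.

Fact fps_mulC : commutative fps_mul.
Proof.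
by move=> f g; apply: fpsP => n; rewrite !(fps_mul_trunc _ _ (ltnSn n)) // mulrC.
Qed.

Fact fps_mul1 : left_id (fpsC 1) fps_mul.
Proof.
move=> f; apply: fpsP => n /=; rewrite big_ord_recl /= mul1r subn0.
by rewrite big1 ?addr0 // => i _; rewrite mul0r.
Qed.

Fact fps_mulDl : left_distributive fps_mul +%R.
Proof.
move=> f g h; apply: fpsP => n /=.
by rewrite -big_split; apply: eq_bigr => i _; rewrite mulrDl.
Qed.

Fact fps_1neq0 : fpsC 1 != 0.
Proof.
apply/eqP => /(congr1 (fun f => fcoef f 0%N)) /= /eqP.
by rewrite oner_eq0.
Qed.

HB.instance Definition _ := GRing.Zmodule_isComNzRing.Build (fps k)
  fps_mulA fps_mulC fps_mul1 fps_mulDl fps_1neq0.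

Definition fps_unit : pred (fps k) := fun f => `[< exists g, g * f = 1 >].
Definition fps_inv f : fps k :=
  if pselect (exists g, g * f = 1) is left e then projT1 (cid e) else f.

Fact fps_mulV : {in fps_unit, left_inverse 1 fps_inv *%R}.
Proof.
move=> f; rewrite inE /fps_inv => fU; case: pselect => [e|//].
by case: (cid e).
Qed.
Fact fps_unitP f g : g * f = 1 -> fps_unit f.
Proof. by move=> gf; apply/asboolP; exists g. Qed.
Fact fps_inv_out : {in [predC fps_unit], fps_inv =1 id}.
Proof.
move=> f; rewrite !inE => /asboolPn fU; rewrite /fps_inv.
by case: pselect.
Qed.

HB.instance Definition _ := GRing.ComNzRing_hasMulInverse.Build (fps k)
  fps_mulV fps_unitP fps_inv_out.

Lemma fps_neq0_order f : f != 0 ->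
  exists n, fcoef f n != 0 /\ forall i, (i < n)%N -> fcoef f i = 0.
Proof.
move=> f0; have ex : exists n, fcoef f n != 0.
  apply: contrapT => nex; move/eqP: f0; apply; apply: fpsP => n /=.
  by apply/eqP; apply: contrapT => fn; apply: nex; exists n; apply/negP.
case: (ex_minnP ex) => n fn min; exists n; split=> // i ltin.
by apply/eqP; apply: contraTT ltin => /min; rewrite -leqNgt.
Qed.

Fact fps_integral f g : f * g = 0 -> (f == 0) || (g == 0).
Proof.
move=> fg0; apply/norP => -[/fps_neq0_order [a [fa mina]]].
case/fps_neq0_order=> b [gb minb].
have := congr1 (fun h => fcoef h (a + b)%N) fg0.
have lt_a : (a < (a + b).+1)%N by rewrite ltnS leq_addr.
rewrite /= (bigD1 (Ordinal lt_a)) //= addKn big1 => [|i].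
  by rewrite addr0 => /eqP; rewrite mulf_eq0 (negPf fa) (negPf gb).
rewrite -val_eqE /= => neq; have [ltia|] := ltnP i a.
  by rewrite mina // mul0r.
rewrite leq_eqVlt eq_sym (negPf neq) /= => ltai.
rewrite [fcoef g _]minb ?mulr0 //.
by rewrite ltn_subLR ?ltn_add2r // -ltnS.
Qed.

HB.instance Definition _ :=
  GRing.ComUnitRing_isIntegral.Build (fps k) fps_integral.

End FpsRing.

Arguments fpsX {k}.

Notation laurent k := {fraction fps k}.

Section Length.
(* [scal] is the action of the base ring [R]; it is a parameter because the
   modules below are modules over [k[[t]]] by restriction of scalars. *)
Variables (R : Type) (U : zmodType) (scal : R -> U -> U).
Local Open Scope classical_set_scope.

Definition is_submodule (N : set U) : Prop :=
  [/\ N 0, forall x y, N x -> N y -> N (x + y)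
    & forall a x, N x -> N (scal a x)].

(* Submodules of A / B are the submodules lying between B and A. *)
Definition submodule_chain (B A : set U) (n : nat) (N : nat -> set U) :=
  (forall i, (i <= n)%N -> [/\ is_submodule (N i), B `<=` N i & N i `<=` A])
  /\ (forall i, (i < n)%N -> N i `<` N i.+1).

Definition is_quotient_length (A B : set U) (n : nat) : Prop :=
  (exists N, submodule_chain B A n N)
  /\ (forall n' N, submodule_chain B A n' N -> (n' <= n)%N).

(* [None] stands for infinite length. *)
Definition quotient_length (A B : set U) : option nat :=
  if pselect (exists n, is_quotient_length A B n) is left e
  then Some (projT1 (cid e)) else None.

End Length.

Section Algebras.
Variable k : fieldType.
Local Notation K := (laurent k).

Definition constK (c : k) : K := FracField.tofrac (fpsC c).

Definition tK : K := FracField.tofrac fpsX.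

Definition fps_in (A : comAlgType K) (f : fps k) : A := (FracField.tofrac f : K)%:A.

Definition integers (A : comAlgType K) : set A :=
  fun x => integralOver (fps_in A) x.

(* Left action of H by K-algebra automorphisms. *)
Definition is_alg_action (gT : finGroupType) (H : {set gT}) (A : algType K)
    (act : gT -> A -> A) : Prop :=
  [/\ forall g, g \in H -> linear (act g) /\ monoid_morphism (act g),
      forall x, act 1%g x = x
    & {in H &, forall g h x, act (g * h)%g x = act g (act h x)}].

(* A/K is a G-etale algebra (Spec A -> Spec K is a G-torsor): A is finite and
   nonzero and A (x)_K A -> Map(G, A), x (x) y |-> (g |-> x * g y), is
   bijective. For a K-basis b of A, A (x)_K A is free over A (acting on the
   left factor) on the 1 (x) b_i. *)
Definition is_Getale (gT : finGroupType) (A : comAlgType K)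
    (act : gT -> A -> A) : Prop :=
  is_alg_action [set: gT] act /\
  exists (n : nat) (b : 'I_n -> A),
    (forall x : A, exists! c : {ffun 'I_n -> K}, x = \sum_i c i *: b i) /\
    (forall f : {ffun gT -> A}, exists! c : {ffun 'I_n -> A},
       forall g, f g = \sum_i c i * act g (b i)).

(* The trivial torsor: A is isomorphic to Map(G, K), on which
   (h f)(g) = f(g h). *)
Definition is_trivial_torsor (gT : finGroupType) (A : comAlgType K)
    (act : gT -> A -> A) : Prop :=
  exists phi : gT -> {lrmorphism A -> K^o},
    bijective (fun x : A => [ffun g => phi g x] : {ffun gT -> K^o}) /\
    (forall g h x, phi g (act h x) = phi (g * h)%g x).

(* Galois with group H, in the sense of Artin: H acts faithfully with fixed
   field K. *)
Definition is_Hextension (gT : finGroupType) (H : {set gT})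
    (E : fieldExtType K) (act : gT -> E -> E) : Prop :=
  [/\ is_alg_action H act,
      forall h, h \in H -> (forall x, act h x = x) -> h = 1%g
    & forall x, (forall h, h \in H -> act h x = x) -> exists c : K, x = c%:A].

(* v is the discrete valuation with value group Z whose valuation ring is O_E,
   the integral closure of k[[t]]; its value at 0 is unconstrained. *)
Definition is_normalised_valuation (E : fieldExtType K) (v : E -> int) : Prop :=
  [/\ forall x y, x != 0 -> y != 0 -> v (x * y) = v x + v y,
      forall x y, x != 0 -> y != 0 -> x + y != 0 ->
        Num.min (v x) (v y) <= v (x + y),
      forall x, x != 0 -> (0 <= v x <-> integers x)
    & exists2 x, x != 0 & v x = 1].

(* The condition sigma pi != pi is there because v is unconstrained at 0. *)
Definition is_ramification_jump (E : fieldExtType K) (v : E -> int)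
    (sigma : E -> E) (r : int) : Prop :=
  exists pi : E, [/\ pi != 0, v pi = 1, sigma pi != pi
                   & v (sigma pi - pi) = r + 1].

End Algebras.

Definition is_root_system (k : fieldType) (p : nat) (zeta : nat -> k) : Prop :=
  (forall n, ~~ (p %| n)%N -> n.-primitive_root (zeta n)) /\
  (forall m n, ~~ (p %| m * n)%N -> zeta (m * n)%N ^+ n = zeta m).

Definition is_semidirect_group (gT : finGroupType) (p m a : nat)
    (sigma tau : gT) : Prop :=
  [/\ #[sigma]%g = p, #[tau]%g = m,
      (<[sigma]> ><| <[tau]>)%g = [set: gT]
    & (tau * sigma * tau^-1 = sigma ^+ a)%g].

Definition m_ (m gamma : nat) : nat := m %/ gcdn gamma m.
Definition dagger (m gamma : nat) : nat := gamma %/ gcdn gamma m.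

Definition tau_ (gT : finGroupType) (m gamma : nat) (tau : gT) : gT :=
  (tau ^+ gcdn gamma m)%g.
Definition H_ (gT : finGroupType) (m gamma : nat) (sigma tau : gT) :
  {group gT} := <<[set sigma; tau_ m gamma tau]>>%G.

(* Coordinates are indexed from 0. The matrix of g has as j-th column the
   coefficients of g(x_j): g(x_j) = \sum_i (V g) i j x_i. *)
Definition is_V (k : fieldType) (gT : finGroupType) (m : nat)
    (zeta : nat -> k) (sigma tau : gT) (d s : nat)
    (V : mx_representation k [set: gT]%G d) : Prop :=
  (forall i j : 'I_d,
     V sigma i j = (i == j)%:R + (i == j.+1 :> nat)%:R) /\
  (forall i j : 'I_d, j = 0%N :> nat ->
     V tau i j = zeta m ^+ s *+ (i == j)).

Section VFunction.
Variables (k : fieldType) (gT : finGroupType) (d : nat).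
Variable V : mx_representation k [set: gT]%G d.
Local Notation K := (laurent k).
Variables (M : comAlgType K) (act : gT -> M -> M).
Local Open Scope classical_set_scope.

Definition integer_vectors : set 'rV[M]_d :=
  [set c | forall j, integers (c 0 j)].

Definition Xi : set 'rV[M]_d :=
  [set c | integer_vectors c /\
     forall g j, act g (c 0 j) = \sum_i constK (V g i j) *: c 0 i].

Definition integer_span (S : set 'rV[M]_d) : set 'rV[M]_d :=
  [set x | exists (n : nat) (a : 'I_n -> M) (y : 'I_n -> 'rV[M]_d),
     (forall i, integers (a i) /\ S (y i)) /\ x = \sum_i a i *: y i].

(* [None] if the length is infinite. *)
Definition v_function : option rat :=
  omap (fun l => l%:R / #|gT|%:R)
    (quotient_length (fun (f : fps k) (x : 'rV[M]_d) => fps_in M f *: x)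
       integer_vectors (integer_span Xi)).

End VFunction.

(* The data attached to a point of Delta_{G,gamma}. The isomorphism
   L = E^{gcd(gamma, m)} is given by its components [phi]; the component [i0]
   is the one on which H_gamma acts through its action on E, and the G-action
   on L is then the induced one. *)
Record Delta_datum (k : fieldType) (p : nat) (zeta : nat -> k)
    (gT : finGroupType) (m : nat) (sigma tau : gT) (gamma : nat)
    (L : comAlgType (laurent k)) (actL : gT -> L -> L) := DeltaDatum {
  dE : fieldExtType (laurent k);
  dact : gT -> dE -> dE;
  dv : dE -> int;
  dr : int;
  dalpha : dE;
  dbeta : dE;
  dphi : 'I_(gcdn gamma m) -> {lrmorphism L -> dE};
  dphi_bij : bijective (fun x : L => [ffun i => dphi i x]);
  dphi_equiv : exists i0, forall h x, h \in H_ m gamma sigma tau ->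
    dphi i0 (actL h x) = dact h (dphi i0 x);
  dext : is_Hextension (H_ m gamma sigma tau) dact;
  dvP : is_normalised_valuation dv;
  drP : is_ramification_jump dv (dact sigma) dr;
  dgen : <<<<1; dalpha>>; dbeta>>%VS = fullv;
  dalpha_root : dalpha ^+ m_ m gamma = (tK k)%:A;
  dbeta_AS : dbeta ^+ p - dbeta \in <<1; dalpha>>%VS;
  dsigma_alpha : dact sigma dalpha = dalpha;
  dsigma_beta : dact sigma dbeta = dbeta + 1;
  dtau_alpha : dact (tau_ m gamma tau) dalpha =
    constK (zeta (m_ m gamma) ^+ dagger m gamma) *: dalpha;
  dtau_beta : dact (tau_ m gamma tau) dbeta =
    constK (zeta (m_ m gamma) ^ (- ((dagger m gamma)%:Z * dr))) *: dbeta;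
  dv_beta : dv dbeta = - dr
}.

Arguments dv {k p zeta gT m sigma tau gamma L actL} _ _.
Arguments dact {k p zeta gT m sigma tau gamma L actL} _ _ _.
Arguments dphi {k p zeta gT m sigma tau gamma L actL} _ _.

(* Inverse of [a] modulo [n], as a natural number, for [a] prime to [n]. *)
Definition inv_mod (a n : nat) : nat := (egcdn a n).1.

Lemma inv_modP (a n : nat) : coprime a n -> a * inv_mod a n = 1 %[mod n].
Proof.
move=> co; case: a co => [|a] co; last first.
  rewrite /inv_mod; case: egcdnP => //= u v eq _.
  by rewrite mulnC eq (eqP co) modnMDl.
by move: co; rewrite /coprime gcd0n => /eqP ->; rewrite !modn1.
Qed.

Definition index_set (m gamma : nat) (d : nat) (r : int) (s : nat) :
    {set 'I_(m_ m gamma) * 'I_d} :=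
  [set ij : 'I_(m_ m gamma) * 'I_d |
    ((ij.1)%:Z - r * (ij.2)%:Z ==
     (s * inv_mod (dagger m gamma) (m_ m gamma))%N%:Z %[mod m_ m gamma])%Z].

Definition v_formula (p m gamma d s : nat) (r valpha vbeta : int) : rat :=
  \sum_(ij in index_set m gamma d r s)
     (ij.1)%:R / (m_ m gamma)%:R
  + (\sum_(ij in index_set m gamma d r s)
       Num.ceil ((- (ij.1)%:Z * valpha - (ij.2)%:Z * vbeta)%:~R
                 / (m_ m gamma * p)%:R : rat))%:~R.

(* Main.v *)
Require Import Defs.
From HB Require Import structures.
From mathcomp Require Import all_boot all_order all_algebra all_fingroup.
From mathcomp Require Import all_field all_character.
From mathcomp Require Import cyclic boolp classical_sets.
From mathcomp Require Import zify ring.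
Set Implicit Arguments.
Unset Strict Implicit.
Unset Printing Implicit Defensive.
Import Order.TTheory GRing.Theory Num.Theory.
Local Open Scope ring_scope.

(** An element of [Xi] is determined by its first coordinate: Xi consists of the
    integral f with (sigma - 1)^d f = 0 and tau f = zeta^s f, together with the
    (sigma - 1)^l f.  On the component E of L, the elements
    omega_ij = t^n_ij alpha^i beta^j (i < m_gamma, j < p), with n_ij the ceiling
    in the formula, have the valuations 0, ..., p m_gamma - 1; since E/K is
    totally ramified of degree p m_gamma they form a basis of the integers over
    k[[t]].  This needs p not dividing r, which follows from
    sigma(beta) = beta + 1.  They are eigenvectors of tau_gamma, and sigma - 1
    lowers the degree in beta, so Xi is free on the omega_ij with (i, j) in the
    index set, which contains one i for each j < d.  The matrix of these
    generators is triangular with diagonal entries j! t^n_ij alpha^i up to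
    constants, so that the length is the sum of g (p i + p m_gamma n_ij), with
    g = gcd(gamma, m) the number of components, divided by #G = p m. *)

(** * Length through composition series *)

(** Two features of the definitions shape the proof. First, the length is a maximum over all chains
    of submodules, so an explicit series must come with an upper bound for every other chain.
    Second, [Delta_datum] gives equivariance for a single component [i0] of L and only under [H_];
    how G moves the other components has to be recovered from L (x) L = Map(G, L). The g components
    are therefore replaced by [dphi x i0] composed with the powers of tau. In component n of these
    coordinates sigma acts as sigma^(a^n), which shifts beta by a^n instead of 1. This multiplies
    the j-th diagonal entry by (a^n)^j, a unit because p does not divide a, so all g components
    contribute equally. Expansions over k[[t]] are built digit by digit, and the remainder vanishes
    because every power of t divides it. That automorphisms preserve [v] comes from their preserving
    integrality. For the trivial torsor, the functions g |-> V g i j on G are integral and give d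
    elements of Xi whose matrix has an integral inverse, so Xi spans everything. *)

Section CompositionSeries.
Variables (R : zmodType) (U : zmodType) (scal : R -> U -> U).
Hypothesis scalN : forall r x, scal (- r) x = - scal r x.
Local Open Scope classical_set_scope.

(** The last clause stands for simplicity of A / B: every nonzero element generates it. Stating it
    on representatives avoids forming the quotient. *)
Definition simple_step (B A : set U) : Prop :=
  [/\ is_submodule scal B, is_submodule scal A, B `<` A
    & forall x y, A x -> A y -> ~ B y -> exists r, B (x - scal r y)].

Inductive comp_length (C : set U) : set U -> nat -> Prop :=
| comp_length0 : is_submodule scal C -> comp_length C C 0
| comp_lengthS B A n :
    comp_length C B n -> simple_step B A -> comp_length C A n.+1.

Lemma comp_length_trans C B A n m :
  comp_length C B n -> comp_length B A m -> comp_length C A (n + m).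
Proof.
move=> CB; elim=> [|B' A' m' _ IH st]; first by rewrite addn0.
by rewrite addnS; apply: comp_lengthS IH st.
Qed.

Lemma comp_length_series C A n : comp_length C A n ->
  exists N : nat -> set U, [/\ N 0%N = C, N n = A,
    forall i, (i < n)%N -> simple_step (N i) (N i.+1) &
    is_submodule scal (N 0)].
Proof.
elim=> [sC|B A' m _ [N [N0 Nm st sN]] stA]; first by exists (fun=> C).
exists (fun i => if (i <= m)%N then N i else A'); split=> //=.
  by rewrite ltnn.
move=> i; have [->|neq] := eqVneq i m; first by rewrite !leqnn ltnn Nm.
rewrite ltnS => ilem; have iltm : (i < m)%N by rewrite ltn_neqAle neq.
by rewrite ilem iltm; apply: st.
Qed.

Section Bound.
Variables (n : nat) (N : nat -> set U).
Hypothesis step : forall i, (i < n)%N -> simple_step (N i) (N i.+1).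

Lemma series_sub i j : (i <= j)%N -> (j <= n)%N -> N i `<=` N j.
Proof.
elim: j => [|j IH]; first by rewrite leqn0 => /eqP -> _ x.
rewrite leq_eqVlt => /predU1P[-> _ x //|ij] jn.
have [_ _ [NN _] _] := step jn.
by apply: subset_trans (IH _ (ltnW jn)) NN; rewrite -ltnS.
Qed.

Lemma series_submodule i : is_submodule scal (N 0) -> (i <= n)%N ->
  is_submodule scal (N i).
Proof. by case: i => // i _ iltn; have [] := step iltn. Qed.

(** As the layers are simple, a submodule either covers a layer or misses it; the set of covered
    layers is a finite invariant that can be compared along a chain. *)
Definition jumps (M : set U) : {set 'I_n} :=
  [set i : 'I_n | `[< exists x, [/\ M x, N i.+1 x & ~ N i x] >]].

Lemma jumpsP (M : set U) (i : 'I_n) :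
  reflect (exists x, [/\ M x, N i.+1 x & ~ N i x]) (i \in jumps M).
Proof. by rewrite finset.in_set; apply: asboolP. Qed.

Lemma jumpsS (M M' : set U) : M `<=` M' -> jumps M \subset jumps M'.
Proof.
move=> MM'; apply/fintype.subsetP => i /jumpsP [x [Mx Nx nNx]].
by apply/jumpsP; exists x; split=> //; apply: MM'.
Qed.

(* As the quotients are simple, an element of M in N i.+1 but not in N i
   generates N i.+1 over N i: climb the series. *)
Lemma jumps_inj (M M' : set U) :
    is_submodule scal M -> is_submodule scal M' ->
    N 0 `<=` M -> M `<=` M' -> M' `<=` N n -> jumps M = jumps M' -> M' `<=` M.
Proof.
move=> [_ MD MZ] [_ MD' MZ'] N0M MM' M'N eqJ x M'x.
suff IH : forall i, (i <= n)%N -> forall y, M' y -> N i y -> M y.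
  exact: (IH n (leqnn n) x M'x (M'N x M'x)).
elim=> [_ y _ /N0M //|i IH iltn y M'y Ny].
have [Niy|nNiy] := pselect (N i y); first exact: IH (ltnW iltn) y M'y Niy.
have : Ordinal iltn \in jumps M.
  by rewrite eqJ; apply/jumpsP; exists y.
move=> /jumpsP [z [Mz Nz nNz]].
have [_ _ _ /(_ y z Ny Nz nNz) [r Nr]] := step iltn.
rewrite -[y](subrK (scal r z)); apply: (MD _ _ _ (MZ r z Mz)).
apply: (IH (ltnW iltn)) => //; rewrite -scalN; apply: (MD' _ _ M'y).
exact/MM'/MZ.
Qed.

(** Along a strict chain the jump sets grow strictly, by [jumps_inj], inside a set of n indices. *)
Lemma submodule_chain_bound m (M : nat -> set U) :
  is_submodule scal (N 0) ->
  submodule_chain scal (N 0) (N n) m M -> (m <= n)%N.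
Proof.
move=> sN [between strict].
suff IH i : (i <= m)%N -> (i <= #|jumps (M i)|)%N.
  apply: leq_trans (IH m (leqnn m)) _.
  by rewrite -[leqRHS]card_ord max_card.
elim: i => // i IH iltm; apply: leq_ltn_trans (IH (ltnW iltm)) _.
have [sub nsub] := strict i iltm.
have [sMi N0 _] := between i (ltnW iltm).
have [sMi1 _ MN] := between i.+1 iltm.
apply: proper_card; rewrite finset.properEneq jumpsS // andbT.
by apply/eqP => /(jumps_inj sMi sMi1 N0 sub MN) /nsub.
Qed.

End Bound.

Theorem quotient_length_comp C A n :
  comp_length C A n -> quotient_length scal A C = Some n.
Proof.
move=> /comp_length_series [N [<- <- step sN]].
have hn : is_quotient_length scal (N n) (N 0) n.
  split=> [|m M]; last exact: submodule_chain_bound.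
  exists N; split=> [i ilen|i iltn]; last by have [] := step i iltn.
  split; first exact: series_submodule step _ sN ilen.
    exact: series_sub step _ _ (leq0n i) ilen.
  exact: series_sub step _ _ ilen (leqnn n).
rewrite /quotient_length; case: pselect => [e|]; last by case; exists n.
(* The length picked by choice equals [n], since each of two lengths bounds the chain realising the
   other. *)
case: (cid e) => n' [[M cM] bound] /=; congr Some; apply/eqP.
by case: hn => -[M' /bound ltnn'] /(_ _ _ cM) len'n; rewrite eqn_leq len'n.
Qed.

End CompositionSeries.

(** * Power series and integral elements *)

Section PowerSeries.
Variable k : fieldType.
Implicit Types (f g : fps k) (c : k).

Lemma fcoefD f g n : fcoef (f + g) n = fcoef f n + fcoef g n.
Proof. by []. Qed.

Lemma fcoefC c n : fcoef (fpsC c) n = c *+ (n == 0)%N.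
Proof. by []. Qed.

Lemma fcoefM0 f g : fcoef (f * g) 0 = fcoef f 0 * fcoef g 0.
Proof. by rewrite /= big_ord1. Qed.

Lemma fcoefCM c f n : fcoef (fpsC c * f) n = c * fcoef f n.
Proof.
rewrite /= big_ord_recl /= subn0 mulr1n big1 ?addr0 // => i _.
by rewrite mulr0n mul0r.
Qed.

Lemma fcoefXM f n : fcoef (fpsX * f) n = if n is n'.+1 then fcoef f n' else 0.
Proof.
case: n => [|n]; first by rewrite fcoefM0 /= mul0r.
rewrite /= 2!big_ord_recl /= mul0r add0r mul1r subn1 big1 ?addr0 // => i _.
by rewrite mul0r.
Qed.

Fact fpsC_zmod_morphism : zmod_morphism (@fpsC k).
Proof.
by move=> c c'; apply: fpsP => n; rewrite /= mulrnBl.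
Qed.

Fact fpsC_monoid_morphism : monoid_morphism (@fpsC k).
Proof.
split=> // c c'; apply: fpsP => n; rewrite fcoefCM !fcoefC.
by rewrite mulrnAr.
Qed.

HB.instance Definition _ :=
  GRing.isZmodMorphism.Build k (fps k) (@fpsC k) fpsC_zmod_morphism.
HB.instance Definition _ :=
  GRing.isMonoidMorphism.Build k (fps k) (@fpsC k) fpsC_monoid_morphism.

Definition fps_shift f : fps k := Fps (fun n => fcoef f n.+1).

Lemma fps_shiftE f : f = fpsC (fcoef f 0) + fpsX * fps_shift f.
Proof.
apply: fpsP => n; rewrite fcoefD fcoefXM fcoefC.
by case: n => [|n] /=; rewrite ?mulr1n ?mulr0n ?addr0 ?add0r.
Qed.

Lemma fps_factor f : f != 0 ->
  exists n u, f = fpsX ^+ n * u /\ fcoef u 0 != 0.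
Proof.
move=> /fps_neq0_order [n [fn min]]; elim: n f fn min => [|n IH] f fn min.
  by exists 0%N, f; rewrite expr0 mul1r.
have [||m [u [eq u0]]] := IH (fps_shift f); first by [].
  by move=> i iltn; apply: min.
exists m.+1, u; split=> //; rewrite {1}[f]fps_shiftE (min 0%N) // raddf0 add0r.
by rewrite exprS -mulrA -eq.
Qed.

Fact constK_zmod_morphism : zmod_morphism (@constK k).
Proof. by move=> c c'; rewrite /constK !rmorphB. Qed.

Fact constK_monoid_morphism : monoid_morphism (@constK k).
Proof. by split=> [|c c']; rewrite /constK ?rmorph1 ?rmorphM. Qed.

HB.instance Definition _ :=
  GRing.isZmodMorphism.Build k (laurent k) (@constK k) constK_zmod_morphism.
HB.instance Definition _ :=
  GRing.isMonoidMorphism.Build k (laurent k) (@constK k) constK_monoid_morphism.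

Lemma fpsX_neq0 : fpsX != 0 :> fps k.
Proof.
by apply/eqP => /(congr1 (fun f => fcoef f 1)) /= /eqP; rewrite oner_eq0.
Qed.

Lemma tK_neq0 : tK k != 0.
Proof. by rewrite tofrac_eq0 fpsX_neq0. Qed.

End PowerSeries.

Section Integers.
Variables (k : fieldType) (A : comAlgType (laurent k)).
Implicit Types (x y : A) (f : fps k).

Fact fps_in_zmod_morphism : zmod_morphism (fps_in A).
Proof. by move=> f g; rewrite /fps_in rmorphB scalerBl. Qed.

Fact fps_in_monoid_morphism : monoid_morphism (fps_in A).
Proof.
split=> [|f g]; rewrite /fps_in ?rmorph1 ?scale1r // rmorphM.
by rewrite -scalerAl mul1r scalerA.
Qed.

HB.instance Definition _ :=
  GRing.isZmodMorphism.Build (fps k) A (fps_in A) fps_in_zmod_morphism.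
HB.instance Definition _ :=
  GRing.isMonoidMorphism.Build (fps k) A (fps_in A) fps_in_monoid_morphism.

Lemma integers_fps f : integers (fps_in A f).
Proof. exact: integral_id. Qed.

Lemma integers0 : integers (0 : A).
Proof. exact: integral0. Qed.

Lemma integersD x y : integers x -> integers y -> integers (x + y).
Proof. exact: integral_add. Qed.

Lemma integersB x y : integers x -> integers y -> integers (x - y).
Proof. exact: integral_sub. Qed.

Lemma integersM x y : integers x -> integers y -> integers (x * y).
Proof. exact: integral_mul. Qed.

Lemma integers_sum (I : Type) (r : seq I) (P : pred I) (F : I -> A) :
  (forall i, P i -> integers (F i)) -> integers (\sum_(i <- r | P i) F i).
Proof.
by move=> iF; elim/big_ind: _ => //; [exact: integers0 | exact: integersD].
Qed.

Lemma integers_const (c : k) : integers ((constK c)%:A : A).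
Proof. exact: (integers_fps (fpsC c)). Qed.

Lemma integers_constZ (c : k) x : integers x -> integers (constK c *: x).
Proof.
by move=> ix; rewrite -mulr_algl; apply: integersM ix; apply: integers_const.
Qed.

End Integers.

Lemma integers_rmorph (k : fieldType) (A B : comAlgType (laurent k))
  (phi : {lrmorphism A -> B}) x : integers x -> integers (phi x).
Proof.
case=> q qmon /rootP qx; exists q => //; apply/rootP.
have -> : map_poly (fps_in B) q = map_poly phi (map_poly (fps_in A) q).
  rewrite -map_poly_comp; apply: eq_map_poly => f /=.
  by rewrite /fps_in linearZ rmorph1.
by rewrite horner_map qx rmorph0.
Qed.

(** * Valuations of extensions of k((t)) *)

Lemma fraction_quotient (R : idomainType) (c : {fraction R}) :
  exists n d : R, d != 0 /\ c = FracField.tofrac n / FracField.tofrac d.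
Proof.
elim/quotW: c => x; exists \n_x, \d_x.
have d0 : \d_x != 0 by apply: denom_ratioP.
split=> //; apply/(canRL (mulfK _)); first by rewrite tofrac_eq0.
unlock FracField.tofrac; rewrite -[LHS]FracField.pi_mul.
apply/eqmodP; rewrite /= FracField.equivfE /FracField.mulf.
by rewrite !numden_Ratio ?oner_eq0 ?mulr1 ?mul1r // mulrC.
Qed.

Section Valuation.
Variables (k : closedFieldType) (E : fieldExtType (laurent k)) (v : E -> int).
Hypothesis hv : is_normalised_valuation v.
Implicit Types (x y z : E) (n m : int).

Let K := laurent k.
Let tE : E := (tK k)%:A.

Lemma valuM x y : x != 0 -> y != 0 -> v (x * y) = v x + v y.
Proof. by case: hv => + _ _ _; apply. Qed.

Lemma valu1 : v 1 = 0.
Proof.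
have := valuM (oner_neq0 E) (oner_neq0 E); rewrite mulr1 => /eqP.
by rewrite -subr_eq subrr eq_sym => /eqP.
Qed.

Lemma valuN x : v (- x) = v x.
Proof.
have [->|x0] := eqVneq x 0; first by rewrite oppr0.
have N1 : (-1 : E) != 0 by rewrite oppr_eq0 oner_neq0.
have := valuM N1 N1; rewrite mulrNN mulr1 valu1 => vN1.
have {}vN1 : v (-1) = 0 by lia.
by rewrite -mulN1r valuM // vN1 add0r.
Qed.

Lemma valuX x i : x != 0 -> v (x ^+ i) = i%:Z * v x.
Proof.
move=> x0; elim: i => [|i IH]; first by rewrite expr0 valu1 mul0r.
by rewrite exprS valuM ?expf_neq0 // IH intS mulrDl mul1r.
Qed.

Lemma valuV x : x != 0 -> v x^-1 = - v x.
Proof.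
move=> x0; have := valuM x0 (invr_neq0 x0); rewrite divff // valu1.
by move=> h; lia.
Qed.

Lemma valuXz x n : x != 0 -> v (x ^ n) = n * v x.
Proof.
move=> x0; case: n => i; first exact: valuX.
by rewrite NegzE -exprnN valuV ?expf_neq0 // valuX // mulNr.
Qed.

Lemma val_prod (I : eqType) (r : seq I) (F : I -> E) :
  (forall i, i \in r -> F i != 0) -> v (\prod_(i <- r) F i) = \sum_(i <- r) v (F i).
Proof.
elim: r => [|i r IH] F0; first by rewrite !big_nil valu1.
have F0' j : j \in r -> F j != 0 by move=> jr; rewrite F0 // inE jr orbT.
rewrite !big_cons valuM ?IH ?F0 ?mem_head //.
by rewrite prodf_seq_neq0; apply/allP => j /F0' /=.
Qed.

(** The value of [v] at 0 is unconstrained, so a lower bound has to admit 0 separately; this makes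
    the sets of elements of value at least n closed under addition. *)
Definition vge x n : Prop := x = 0 \/ n <= v x.

Lemma vge0 n : vge 0 n. Proof. by left. Qed.

Lemma vge_val x : vge x (v x). Proof. by right. Qed.

Lemma vge_le x n m : m <= n -> vge x n -> vge x m.
Proof. by move=> mn [->|nx]; [left|right; apply: le_trans nx]. Qed.

Lemma vgeP x n : x != 0 -> vge x n <-> n <= v x.
Proof. by move=> x0; split=> [[/eqP|]|]; rewrite ?(negPf x0) //; right. Qed.

Lemma vgeD x y n : vge x n -> vge y n -> vge (x + y) n.
Proof.
have [->|x0] := eqVneq x 0; first by rewrite add0r.
have [->|y0] := eqVneq y 0; first by rewrite addr0.
move=> /(vgeP _ x0) nx /(vgeP _ y0) ny.
have [->|xy0] := eqVneq (x + y) 0; first exact: vge0.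
case: hv => _ /(_ _ _ x0 y0 xy0) le _ _; right; apply: le_trans le.
by rewrite le_min nx.
Qed.

Lemma vgeN x n : vge x n -> vge (- x) n.
Proof. by case=> [->|nx]; [left; rewrite oppr0|right; rewrite valuN]. Qed.

Lemma vgeB x y n : vge x n -> vge y n -> vge (x - y) n.
Proof. by move=> xn yn; apply/vgeD/vgeN. Qed.

Lemma vgeM x y n m : vge x n -> vge y m -> vge (x * y) (n + m).
Proof.
have [->|x0] := eqVneq x 0; first by rewrite mul0r => *; apply: vge0.
have [->|y0] := eqVneq y 0; first by rewrite mulr0 => *; apply: vge0.
move=> /(vgeP _ x0) nx /(vgeP _ y0) ny; right; rewrite valuM //.
exact: lerD.
Qed.

Lemma vgeMl x y n m : vge x n -> 0 <= m -> vge y m -> vge (x * y) n.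
Proof. by move=> xn m0 ym; apply: vge_le (vgeM xn ym); rewrite lerDl. Qed.

Lemma vgeX x n i : vge x n -> vge (x ^+ i) (i%:Z * n).
Proof.
move=> xn; elim: i => [|i IH]; first by right; rewrite expr0 valu1 mul0r.
by rewrite exprS intS mulrDl mul1r; apply: vgeM.
Qed.

Lemma vge_sum (I : Type) (r : seq I) (P : pred I) (F : I -> E) n :
  (forall i, P i -> vge (F i) n) -> vge (\sum_(i <- r | P i) F i) n.
Proof.
by move=> vF; elim/big_ind: _ => //; [exact: vge0 | move=> *; apply: vgeD].
Qed.

Lemma vge_inf x : (forall i : nat, vge x i%:Z) -> x = 0.
Proof.
move=> xi; apply/eqP; apply: contrapT => /negP x0.
by have /(vgeP _ x0) := xi `|v x|.+1; lia.
Qed.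

Lemma vge_div x y n : y != 0 -> vge x n -> vge (x / y) (n - v y).
Proof.
move=> y0 [->|xn]; first by rewrite mul0r; left.
have [->|x0] := eqVneq x 0; first by rewrite mul0r; left.
by right; rewrite valuM ?invr_eq0 // valuV // lerD2r.
Qed.

Lemma integersE x : integers x <-> vge x 0.
Proof.
have [->|x0] := eqVneq x 0.
  by split=> _; [exact: vge0 | exact: integers0].
case: hv => _ _ /(_ x x0) eqv _; rewrite vgeP //.
by rewrite eqv.
Qed.

(** If x + y vanished or had larger value, so would x = (x + y) - y. *)
Lemma vgeD_neq0 x y n : x != 0 -> v x = n -> vge y (n + 1) ->
  x + y != 0 /\ v (x + y) = n.
Proof.
move=> x0 vx yn.
have nxy : ~ vge (x + y) (n + 1).
  move=> /vgeB /(_ yn); rewrite addrK => /(vgeP _ x0); rewrite vx; lia.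
have xy0 : x + y != 0 by apply/eqP => xy0; apply: nxy; rewrite xy0; left.
split=> //; have : vge (x + y) n.
  by apply: vgeD; [right; rewrite vx | apply: vge_le yn; lia].
move=> /(vgeP _ xy0) le; apply/eqP; rewrite eq_le le andbT leNgt -lezD1.
by apply/negP => lt; apply: nxy; right.
Qed.

Lemma scal_neq0 (c : K) : c != 0 -> c%:A != 0 :> E.
Proof. by rewrite scaler_eq0 oner_eq0 orbF. Qed.

Lemma const_neq0 (c : k) : c != 0 -> (constK c)%:A != 0 :> E.
Proof. by move=> c0; rewrite scal_neq0 // fmorph_eq0. Qed.

Lemma fps_in_neq0 (f : fps k) : f != 0 -> fps_in E f != 0.
Proof. by move=> f0; rewrite scal_neq0 // tofrac_eq0. Qed.

Lemma fps_in_inj : injective (fps_in E).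
Proof.
apply: raddf_inj => f /eqP; apply: contraTeq => f0; exact: fps_in_neq0.
Qed.

Lemma vge_fps f : vge (fps_in E f) 0.
Proof. by apply/integersE/integers_fps. Qed.

Lemma vge_const (c : k) : vge ((constK c)%:A) 0.
Proof. exact: (vge_fps (fpsC c)). Qed.

Lemma val_const (c : k) : c != 0 -> v ((constK c)%:A) = 0.
Proof.
move=> c0; have c0' := const_neq0 c0.
have /(vgeP _ c0') vc := vge_const c.
have /vgeP -/(_ (const_neq0 (invr_neq0 c0))) := vge_const c^-1.
have -> : (constK c^-1)%:A = ((constK c)%:A)^-1 :> E.
  apply: (mulfI c0'); rewrite divff // -scalerAl mul1r scalerA.
  by rewrite -rmorphM divff // rmorph1 scale1r.
by rewrite (valuV c0') oppr_ge0 => vc'; apply/eqP; rewrite eq_le vc' vc.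
Qed.

Lemma tE_neq0 : tE != 0.
Proof. exact/scal_neq0/tK_neq0. Qed.

Lemma fps_inX : fps_in E fpsX = tE. Proof. by []. Qed.

(* After clearing denominators, an integral equation for 1/t would have the
   constant coefficient 1 = 0. *)
Lemma val_t_gt0 : 0 < v tE.
Proof.
have /(vgeP _ tE_neq0) := vge_fps fpsX.
rewrite le_eqVlt => /predU1P[vt0|//].
have : integers tE^-1.
  by apply/integersE; right; rewrite valuV ?tE_neq0 // -vt0 oppr0.
case=> q qmon /rootP; rewrite horner_coef.
have size_q : size (map_poly (fps_in E) q) = size q.
  by rewrite size_map_inj_poly ?rmorph0 //; exact: fps_in_inj.
rewrite size_q.
have [n szq] : exists n : nat, size q = n.+1.
  by exists (size q).-1; rewrite prednK // size_poly_gt0 monic_neq0.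
move=> /(congr1 ( *%R (tE ^+ n))); rewrite mulr0 mulr_sumr szq big_ord_recr /=.
have -> : (map_poly (fps_in E) q)`_n = 1.
  have qn : q`_n = 1 by rewrite -[RHS](monicP qmon) lead_coefE szq.
  by rewrite coef_map /= qn rmorph1.
rewrite mul1r -exprMn divff ?tE_neq0 // expr1n.
have -> : \sum_(i < n) tE ^+ n * ((map_poly (fps_in E) q)`_i * tE^-1 ^+ i)
   = fps_in E (fpsX * \sum_(i < n) fpsX ^+ (n - i.+1) * q`_i).
  rewrite rmorphM rmorph_sum /= mulr_sumr; apply: eq_bigr => i _.
  rewrite rmorphM rmorphXn /= fps_inX coef_map /= [RHS]mulrA -exprS.
  rewrite subnSK // mulrCA mulrC; congr (_ * _).
  rewrite exprVn expfB_cond // (negPf tE_neq0) add0n.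
  exact: ltnW.
rewrite -[X in _ + X](rmorph1 (fps_in E)) -rmorphD -(rmorph0 (fps_in E)).
move=> /fps_in_inj.
move=> /(congr1 (fun f => fcoef f 0)); rewrite fcoefD fcoefXM add0r /= => /eqP.
by rewrite oner_eq0.
Qed.

Definition ramif : nat := `|v tE|.

Lemma val_t : v tE = ramif%:Z.
Proof. by rewrite /ramif gez0_abs // ltW // val_t_gt0. Qed.

Lemma ramif_gt0 : (0 < ramif)%N.
Proof. by have := val_t_gt0; rewrite val_t. Qed.

Lemma vge_tM x : vge x 0 -> vge (tE * x) 1.
Proof.
move=> x0; rewrite mulrC; apply: vge_le (vgeM x0 (vge_val tE)).
by have := val_t_gt0; lia.
Qed.

(** An element of K is a quotient of power series, and a nonzero power series is a power of t times
    a unit, which has value 0. *)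
Lemma val_scal (c : K) : c != 0 -> (ramif%:Z %| v c%:A)%Z.
Proof.
suff vfps (f : fps k) : f != 0 -> (ramif%:Z %| v (fps_in E f))%Z.
  have [f [g [g0 ->]]] := fraction_quotient c => fg0.
  have f0 : f != 0 by apply: contraNneq fg0 => ->; rewrite rmorph0 mul0r.
  have -> : (FracField.tofrac f / FracField.tofrac g)%:A = fps_in E f / fps_in E g.
    apply: (canRL (mulfK (fps_in_neq0 g0))).
    by rewrite /fps_in -scalerAl mul1r scalerA divfK ?tofrac_eq0.
  rewrite valuM ?invr_eq0 ?fps_in_neq0 // valuV ?fps_in_neq0 //.
  by rewrite rpredB ?vfps.
move=> /fps_factor [n [u [-> u0]]].
have [u0' vu] : fps_in E u != 0 /\ v (fps_in E u) = 0.
  rewrite [u]fps_shiftE rmorphD rmorphM /= fps_inX.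
  apply: vgeD_neq0; [exact: const_neq0 | exact: val_const |].
  by apply/vge_tM/vge_fps.
rewrite rmorphM rmorphXn /= fps_inX valuM ?expf_neq0 ?tE_neq0 //.
by rewrite vu addr0 valuX ?tE_neq0 // val_t dvdz_mull.
Qed.

(** Scalars shift values by multiples of [ramif], so the nonzero terms have pairwise distinct values
    and the one of least value cannot be cancelled. *)
Lemma distinct_val_free (I : finType) (w : I -> E) (c : I -> K) :
    (forall i, w i != 0) ->
    (forall i j, v (w i) = v (w j) %[mod ramif]%Z -> i = j) ->
  \sum_i c i *: w i = 0 -> forall i, c i = 0.
Proof.
move=> w0 winj sum0 i0; apply/eqP; apply: contrapT => /negP ci0.
pose u i := v (c i *: w i).
case: (@arg_minP _ _ _ i0 (fun i => c i != 0) u ci0) => i ci min.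
have uE j : c j != 0 -> u j = v (c j)%:A + v (w j).
  by move=> cj; rewrite /u -(mulr_algl _ (w j)) valuM ?scal_neq0.
have := sum0; rewrite (bigD1 i) //= => /eqP; apply/negP.
apply: (proj1 (@vgeD_neq0 _ _ (u i) _ _ _)) => //.
  by rewrite scaler_eq0 negb_or ci w0.
apply: vge_sum => j ji; have [->|cj] := eqVneq (c j) 0.
  by rewrite scale0r; left.
right; rewrite lezD1 lt_neqAle min // andbT; apply: contra ji => /eqP.
rewrite -/(u j) !uE // => eq_u; apply/eqP/winj/eqP.
have /dvdzP [a va] := val_scal cj; have /dvdzP [b vb] := val_scal ci.
rewrite eqz_mod_dvd; apply/dvdzP; exists (b - a).
by rewrite mulrBl -va -vb; lia.
Qed.

(* The residue field is k: modulo t, an integral equation for x splits into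
   linear factors with roots in k, so some x - c is not a unit. *)
Lemma residue x : vge x 0 -> exists c : k, vge (x - (constK c)%:A) 1.
Proof.
move=> vx; have /integersE [q qmon /rootP qx] := vx.
pose q0 : {poly k} := map_poly (fun f => fcoef f 0) q.
pose C (c : k) : E := (constK c)%:A.
have Czmod : zmod_morphism C by move=> c c'; rewrite /C rmorphB scalerBl.
have Cmon : monoid_morphism C.
  split=> [|c c']; rewrite /C ?rmorph1 ?scale1r // rmorphM.
  by rewrite -scalerAl mul1r scalerA.
pose Ca := GRing.isZmodMorphism.Build _ _ C Czmod.
pose Cm := GRing.isMonoidMorphism.Build _ _ C Cmon.
pose CR : {rmorphism k -> E} := HB.pack C Ca Cm.
have q0E : map_poly (fps_in E) q =
    map_poly CR q0 + tE *: \poly_(i < size q) fps_in E (fps_shift q`_i).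
  apply/polyP => i; rewrite coefD coefZ !coef_map_id0 ?rmorph0 // coef_poly.
  rewrite {1}[q`_i]fps_shiftE rmorphD rmorphM /= fps_inX; congr (_ + _).
  case: ltnP => // szi; rewrite nth_default //.
  by rewrite (_ : fps_shift 0 = 0) ?rmorph0 //; apply: fpsP.
have q0mon : q0 \is monic.
  have lc : fcoef (lead_coef q) 0 = 1 by rewrite (monicP qmon).
  have szq0 : size q0 = size q.
    rewrite size_poly_eq // lc oner_neq0 //.
  by rewrite monicE lead_coefE szq0 coef_map_id0 // -lead_coefE lc.
have [rs q0rs] := closed_field_poly_normal q0.
rewrite (monicP q0mon) scale1r in q0rs.
have vq0 : vge (\prod_(z <- rs) (x - C z)) 1.
  have -> : \prod_(z <- rs) (x - C z) = (map_poly CR q0).[x].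
    rewrite q0rs rmorph_prod horner_prod; apply: eq_bigr => z _.
    by rewrite [X in X.[x]](map_polyXsubC CR z) hornerXsubC.
  have /eqP := qx; rewrite q0E hornerD addr_eq0 => /eqP ->.
  apply: vgeN; rewrite hornerZ; apply: vge_tM; rewrite horner_poly.
  apply: vge_sum => i _; apply: (vgeMl (vge_fps _) (lexx 0)).
  by have := vgeX i vx; rewrite mulr0.
apply: contrapT => nx.
have xC (z : k) : x - C z != 0 /\ v (x - C z) = 0.
  have nge : ~ vge (x - C z) 1 by move=> h; apply: nx; exists z.
  have xz : x - C z != 0 by apply/eqP => xz; apply: nge; left.
  split=> //; have /(vgeP _ xz) : vge (x - C z) 0 by apply/vgeB/vge_const.
  have : ~ 1 <= v (x - C z) by move=> h; apply: nge; right.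
  lia.
move: vq0; rewrite vgeP; last first.
  by rewrite prodf_seq_neq0; apply/allP => z _; case: (xC z).
rewrite val_prod => [|z _]; last by case: (xC z).
by rewrite big1 // => z _; case: (xC z).
Qed.

End Valuation.

(** * Expansion along a system of prescribed valuations *)

Section Expansion.
Variables (k : closedFieldType) (E : fieldExtType (laurent k)) (v : E -> int).
Hypothesis hv : is_normalised_valuation v.
Local Notation e := (ramif v).
Local Notation tE := ((tK k)%:A : E).

Section Basis.
Variable w : nat -> E.
Hypothesis w_neq0 : forall i, (i < e)%N -> w i != 0.
Hypothesis val_w : forall i, (i < e)%N -> v (w i) = i%:Z.

(** One digit at a time: the remainder divided by [w n] is integral, and its residue in k is the
    next coefficient. *)
Lemma leading_digits x n : (n <= e)%N -> vge v x 0 ->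
  exists c : nat -> k, vge v (x - \sum_(i < n) constK (c i) *: w i) n%:Z.
Proof.
move=> + vx; elim: n => [|n IH] ltne.
  by exists (fun=> 0); rewrite big_ord0 subr0.
have [c vc] := IH (ltnW ltne).
set y := x - _ in vc; have w0 := w_neq0 ltne.
have [|c' vc'] := @residue _ _ _ hv (y / w n).
  by have := vge_div hv w0 vc; rewrite val_w // subrr.
exists (fun i => if i == n then c' else c i); rewrite big_ord_recr /= eqxx.
have -> : \sum_(i < n) constK (if i == n :> nat then c' else c i) *: w i
   = \sum_(i < n) constK (c i) *: w i.
  by apply: eq_bigr => i _; rewrite ltn_eqF.
have -> : x - (\sum_(i < n) constK (c i) *: w i + constK c' *: w n) =
    w n * (y / w n - (constK c')%:A).
  rewrite mulrBr mulrCA divff // mulr1 -scalerAr mulr1 opprD addrA.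
  by [].
rewrite -addn1 PoszD; apply: (vgeM hv _ vc'); right.
by rewrite (val_w ltne).
Qed.

(** Removing [e] digits leaves t times an integral element, on which the process restarts. The i-th
    digits of the successive rounds are the coefficients of [a i]. *)
Lemma integral_expansion x : vge v x 0 ->
  exists a : nat -> fps k, x = \sum_(i < e) fps_in E (a i) * w i.
Proof.
move=> vx; pose next y (cz : (nat -> k) * E) := vge v y 0 ->
  vge v cz.2 0 /\ y = \sum_(i < e) constK (cz.1 i) *: w i + tE * cz.2.
have [F FP] : {F & forall y, next y (F y)}.
  apply: choice => y; have [vy|nvy] := pselect (vge v y 0); last first.
    by exists (fun=> 0, 0) => /nvy.
  have [c vc] := leading_digits (leqnn e) vy.
  set s := \sum_(i < e) _ in vc.
  have t0 := tE_neq0 E.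
  exists (c, (y - s) / tE) => _ /=; split.
    by have := vge_div hv t0 vc; rewrite (val_t hv) subrr.
  by rewrite mulrCA divff // mulr1 addrC subrK.
pose X q := iter q (fun y => (F y).2) x.
have vX q : vge v (X q) 0 by elim: q => // q /FP [].
(* The series are read from round [q] on, so that shifting [a q i] gives [a q.+1 i] and the
   remainders satisfy Y q = t Y (q + 1). *)
pose a q i := Fps (fun n => (F (X (q + n)%N)).1 i).
exists (a 0%N); apply/eqP; rewrite -subr_eq0; apply/eqP.
pose Y q := X q - \sum_(i < e) fps_in E (a q i) * w i.
have vY q : vge v (Y q) 0.
  apply/(vgeB hv (vX q))/(vge_sum hv) => i _.
  apply: (vgeMl hv (vge_fps hv _) (lexx 0)).
  by right; rewrite val_w.
have YS q : Y q = tE * Y q.+1.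
  have [_ XE] := FP _ (vX q); rewrite /Y {1}XE mulrBr addrC addrA [RHS]addrC.
  congr (_ + _); rewrite mulr_sumr -sumrN -big_split /= -sumrN.
  apply: eq_bigr => i _; rewrite [a q i]fps_shiftE rmorphD rmorphM /= addn0.
  rewrite (_ : fps_shift (a q i) = a q.+1 i); last first.
    by apply: fpsP => n; rewrite /fps_shift /a /fcoef addSnnS.
  rewrite mulrDl opprD addrAC /fps_in -/(constK _) mulr_algl addNr add0r.
  by rewrite -/(tK k) mulrA.
have Y0 q : Y 0%N = tE ^+ q * Y q.
  by elim: q => [|q IH]; rewrite ?mul1r // IH YS mulrA -exprSr.
apply: (@vge_inf _ _ v) => q; rewrite -/(Y 0%N) (Y0 q).
apply: (vgeMl hv _ (lexx 0) (vY q)).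
have := vgeX hv q (vge_val v tE); apply: vge_le.
rewrite (val_t hv); have := ramif_gt0 hv; nia.
Qed.

Lemma field_expansion x :
  exists c : 'I_e -> laurent k, x = \sum_i c i *: w i.
Proof.
have t0 := tE_neq0 E.
pose N := `|v x|%N.
have [|a xa] := @integral_expansion (tE ^+ N * x).
  have [->|x0] := eqVneq x 0; first by rewrite mulr0; left.
  right; rewrite (valuM hv) ?expf_neq0 // (valuX hv) // (val_t hv).
  have := ramif_gt0 hv; rewrite /N; nia.
exists (fun i => (tK k) ^- N * FracField.tofrac (a i)).
apply: (mulfI (expf_neq0 N t0)); rewrite xa mulr_sumr; apply: eq_bigr => i _.
rewrite -scalerAr scalerAl; congr (_ * _); rewrite exprZn expr1n scalerA.
by rewrite mulrAC mulVf ?expf_neq0 ?tK_neq0 // mul1r.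
Qed.

End Basis.

(** The first [e] powers of a uniformiser span E by expansion, because the residue field is k, and
    are independent because of their values. *)
Lemma ramif_dim : e = \dim {:E}.
Proof.
case: hv => _ _ _ [pi pi0 vpi].
have w0 i : (i < e)%N -> pi ^+ i != 0 by rewrite expf_neq0.
have vw i : (i < e)%N -> v (pi ^+ i) = i%:Z.
  by rewrite (valuX hv) // vpi mulr1.
pose X := [tuple pi ^+ i | i < e].
have nthX (i : 'I_e) : X`_i = pi ^+ i by rewrite -tnth_nth tnth_mktuple.
suff /size_basis -> : basis_of {:E} X by [].
rewrite basisEdim; apply/andP; split.
  apply/subvP => x _; have [c ->] := field_expansion w0 vw x.
  apply: memv_suml => i _; apply/memvZ/memv_span.
  by rewrite -nthX mem_nth // size_tuple.
rewrite size_tuple -[leqLHS](size_tuple X) -(_ : \dim <<X>> = size X).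
  exact/dimvS/subvf.
apply/eqP/freeP => c; under eq_bigr do rewrite nthX.
apply: (distinct_val_free hv) => [i|i j]; first exact: w0.
rewrite !vw // !modz_nat !modn_small // => -[]; exact: val_inj.
Qed.

End Expansion.

(** * Automorphisms and the ramification jump *)

Section Automorphism.
Variables (k : closedFieldType) (E : fieldExtType (laurent k)) (v : E -> int).
Hypothesis hv : is_normalised_valuation v.
Variable S : {lrmorphism E -> E}.

(** [S] preserves integrality, hence units. It fixes t, and x^e t^(- v x) is a unit, so comparing
    values determines v (S x). *)
Lemma val_aut x : x != 0 -> v (S x) = v x.
Proof.
move=> x0; have e0 := ramif_gt0 hv.
have [t [t0 St vt]] : exists t, [/\ t != 0, S t = t & v t = ramif v].
  exists (tK k)%:A; split; [exact: tE_neq0 | | exact: val_t].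
  by rewrite linearZ rmorph1.
have vS y : y != 0 -> v y = 0 -> v (S y) = 0.
  move=> y0 vy; have Sy0 : S y != 0 by rewrite fmorph_eq0.
  have pos z : z != 0 -> v z = 0 -> 0 <= v (S z).
    move=> z0 vz; have Sz0 : S z != 0 by rewrite fmorph_eq0.
    apply/(vgeP _ _ Sz0)/(integersE hv)/integers_rmorph/(integersE hv).
    by right; rewrite vz.
  apply/eqP; rewrite eq_le pos // andbT -oppr_ge0 -(valuV hv) // -fmorphV.
  by rewrite pos ?invr_eq0 // (valuV hv) // vy.
have StX n : S (t ^ n) = t ^ n.
  by case: n => n; rewrite ?NegzE -?exprnN ?fmorphV rmorphXn /= St.
pose u := x ^+ ramif v * t ^ (- v x).
have u0 : u != 0 by rewrite mulf_neq0 ?expf_neq0 ?expfz_neq0.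
have vu : v u = 0.
  rewrite (valuM hv) ?expf_neq0 ?expfz_neq0 // (valuX hv) // (valuXz hv) //.
  by rewrite vt mulNr mulrC subrr.
have := vS u u0 vu; rewrite rmorphM /= StX rmorphXn /=.
rewrite (valuM hv) ?expf_neq0 ?expfz_neq0 ?fmorph_eq0 //.
rewrite (valuX hv) ?fmorph_eq0 // (valuXz hv) // vt mulNr.
move=> /eqP; rewrite subr_eq0 mulrC => /eqP/mulIf -> //.
by rewrite -lt0n in e0 *.
Qed.

Lemma vge_aut x n : vge v x n -> vge v (S x) n.
Proof.
have [-> _|x0] := eqVneq x 0; first by rewrite rmorph0; left.
by move=> /(vgeP _ _ x0) nx; right; rewrite val_aut.
Qed.

Lemma aut_fps f : S (fps_in E f) = fps_in E f.
Proof. by rewrite /fps_in linearZ rmorph1. Qed.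

Section Jump.
Variables (r : int) (pi : E).
Hypotheses (pi_neq0 : pi != 0) (val_pi : v pi = 1).
Hypothesis jump : vge v (S pi - pi) (r + 1).

Let val_piX i : v (pi ^+ i) = i%:Z.
Proof. by rewrite (valuX hv) // val_pi mulr1. Qed.

(** For i > 0 the difference of powers is S pi - pi times a sum of products of i - 1 factors, each
    factor of value 1. *)
Lemma jump_piX i : vge v (S (pi ^+ i) - pi ^+ i) (i%:Z + r).
Proof.
rewrite rmorphXn /= subrXX; case: i => [|i]; first by rewrite big_ord0 mulr0; left.
have -> : i.+1%:Z + r = r + 1 + i%:Z by lia.
apply: (vgeM hv jump); apply: (vge_sum hv) => j _.
have -> : i%:Z = (i - j)%N%:Z + j%:Z by have := ltn_ord j; lia.
apply: (vgeM hv); last by right; rewrite val_piX.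
by right; rewrite (valuX hv) ?fmorph_eq0 // val_aut // val_pi mulr1.
Qed.

Lemma jump_piXz n : vge v (S (pi ^ n) - pi ^ n) (n + r).
Proof.
case: n => i; first exact: jump_piX.
have p0 : pi ^+ i.+1 != 0 by rewrite expf_neq0.
have Sp0 : S (pi ^+ i.+1) != 0 by rewrite fmorph_eq0.
rewrite NegzE -exprnN fmorphV.
set q := pi ^+ i.+1 in p0 Sp0 *.
have -> : (S q)^-1 - q^-1 = - (S q - q) / (q * S q) by field; apply/andP.
have -> : - i.+1%:Z + r = i.+1%:Z + r - v (q * S q).
  by rewrite (valuM hv) // val_aut // val_piX; lia.
by apply: (vge_div hv); [rewrite mulf_neq0 | apply/(vgeN hv)/jump_piX].
Qed.

Lemma jump_integral x : vge v x 0 -> vge v (S x - x) (r + 1).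
Proof.
have w0 i : (i < ramif v)%N -> pi ^+ i != 0 by rewrite expf_neq0.
move=> /(integral_expansion hv w0 (fun i _ => val_piX i)) [a ->].
rewrite rmorph_sum /= -sumrB; apply: (vge_sum hv) => i _.
rewrite rmorphM /= aut_fps -mulrBr mulrC.
apply: (vgeMl hv _ (lexx 0) (vge_fps hv _)).
have [->|i0] := eqVneq (i : nat) 0%N; first by rewrite rmorph1 subrr; left.
by apply: vge_le (jump_piX i); rewrite addrC lerD2r; case: (nat_of_ord i) i0.
Qed.

(** Write x as an element of value 0 times a power of pi and apply the product rule for S - 1. *)
Lemma jump_bound x : x != 0 -> vge v (S x - x) (v x + r).
Proof.
move=> x0; have pz0 : pi ^ (v x) != 0 by rewrite expfz_neq0.
have vpz : v (pi ^ (v x)) = v x by rewrite (valuXz hv) // val_pi mulr1.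
pose u := x / pi ^ (v x).
have vu : vge v u 0.
  by have := vge_div hv pz0 (vge_val v x); rewrite vpz subrr.
have -> : x = u * pi ^ (v x) by rewrite /u divfK.
have -> : S (u * pi ^ v x) - u * pi ^ v x =
   (S u - u) * S (pi ^ v x) + u * (S (pi ^ v x) - pi ^ v x).
  by rewrite rmorphM /=; ring.
have -> : v (u * pi ^ v x) = v x by rewrite /u divfK.
apply: (vgeD hv).
  have -> : v x + r = (r + 1) + v x - 1 by lia.
  have := vgeM hv (jump_integral vu) (vge_aut (vge_val v (pi ^ v x))).
  by rewrite vpz; apply: vge_le; lia.
by rewrite -[v x + r]add0r; apply: (vgeM hv vu (jump_piXz _)).
Qed.

(* If p divided r, then b would be c y^p plus higher terms, with c a constant;
   S moves y^p by (S y - y)^p, so S b - b = 1 would have positive valuation. *)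
Lemma jump_coprime (p : nat) (b : E) : p \in [pchar E] ->
  0 <= r -> S b = b + 1 -> v b = - r -> ~~ (p %| r)%Z.
Proof.
move=> pE r0 Sb vb; apply/negP => /dvdzP [q rq].
have p1 : (1 < p)%N by apply/prime_gt1/(pcharf_prime pE).
have b0 : b != 0.
  apply: contra_eq_neq Sb => ->; rewrite rmorph0 add0r eq_sym; exact: oner_neq0.
pose y := pi ^ (- q).
have y0 : y != 0 by rewrite expfz_neq0.
have vy : v y = - q by rewrite (valuXz hv) // val_pi mulr1.
have vyp : v (y ^+ p) = v b by rewrite (valuX hv) // vy vb rq; lia.
have yp0 : y ^+ p != 0 by rewrite expf_neq0.
have [|c vc] := @residue _ _ _ hv (b / y ^+ p).
  by have := vge_div hv yp0 (vge_val v b); rewrite vyp subrr.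
pose z := b - (constK c)%:A * y ^+ p.
have vz : vge v z (1 - r).
  rewrite -vb -vyp; have := vgeM hv vc (vge_val v (y ^+ p)).
  by rewrite mulrBl divfK.
have bE : b = (constK c)%:A * y ^+ p + z by rewrite /z addrC subrK.
have one : 1 = (constK c)%:A * (S y - y) ^+ p + (S z - z).
  have Sb1 : S b - b = 1 by rewrite Sb addrC addKr.
  rewrite -[LHS]Sb1 {1 2}bE rmorphD rmorphM rmorphXn /= linearZ /= rmorph1.
  have -> : (S y - y) ^+ p = S y ^+ p - y ^+ p.
    by have := pFrobenius_autB_comm pE (mulrC (S y) y); rewrite !pFrobenius_autE.
  ring.
have : vge v (1 : E) 1.
  rewrite one; apply: (vgeD hv).
    rewrite mulrC; apply: (vgeMl hv _ (lexx 0) (vge_const hv c)).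
    (* The bound obtained from [jump_bound] is p q (p - 1), which is positive only for q > 0; for q
       = 0 the element y is 1 and S fixes it. *)
    have [q0|q0] := eqVneq q 0.
      by rewrite /y q0 oppr0 expr0z rmorph1 subrr expr0n -[p == 0%N]negbK -lt0n
        (ltnW p1); left.
    have := vgeX hv p (jump_bound y0); apply: vge_le; rewrite vy rq.
    nia.
  have [->|z0] := eqVneq z 0; first by rewrite rmorph0 subrr; left.
  apply: vge_le (jump_bound z0).
  by move: vz => /(vgeP _ _ z0); lia.
by rewrite vgeP ?oner_neq0 // (valu1 hv).
Qed.

End Jump.
End Automorphism.

(** * Arithmetic of the exponents and finite differences *)

Lemma prim_expz_eq1 (F : fieldType) n (z : F) (x : int) :
  n.-primitive_root z -> (z ^ x == 1) = (n%:Z %| x)%Z.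
Proof.
move=> zP; case: x => m; first by rewrite -(prim_order_dvd zP).
rewrite NegzE -exprnN invr_eq1 -(prim_order_dvd zP).
by rewrite rpredN.
Qed.

Lemma prim_expz_eq (F : fieldType) n (z : F) (x y : int) : (0 < n)%N ->
  n.-primitive_root z -> (z ^ x == z ^ y) = (x == y %[mod n])%Z.
Proof.
move=> n0 zP; have z0 : z != 0.
  by apply/eqP => z0; have := prim_expr_order zP; rewrite z0 expr0n gtn_eqF //
    => /eqP; rewrite eq_sym oner_eq0.
rewrite eqz_mod_dvd -(prim_expz_eq1 _ zP).
have -> : z ^ x = z ^ (x - y) * z ^ y by rewrite -expfzDr // subrK.
have zy0 : z ^ y != 0 by rewrite expfz_neq0.
by rewrite -subr_eq0 -{2}[z ^ y]mul1r -mulrBl mulf_eq0 (negPf zy0) orbF subr_eq0.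
Qed.

Lemma ceil_divP (a : int) (b : nat) : (0 < b)%N ->
  a <= Num.ceil (a%:~R / b%:R : rat) * b%:Z < a + b%:Z.
Proof.
move=> b0; set N := Num.ceil _; have b0' : 0 < b%:R :> rat by rewrite ltr0n.
have /andP[] := ceil_itv (a%:~R / b%:R : rat).
rewrite -/N ltr_pdivlMr // ler_pdivrMr //.
rewrite -[b%:R]/(b%:Z%:~R) -!intrM ltr_int ler_int => h1 ->.
by move: h1; rewrite mulrBl mul1r ltrBlDr.
Qed.

(** As r is invertible modulo p, some j makes n + j r divisible by p; then i is the quotient reduced
    modulo [mu]. *)
Lemma residue_pair (p mu : nat) (r n : int) :
    prime p -> (0 < mu)%N -> ~~ (p %| r)%Z ->
  exists i j : nat, [/\ (i < mu)%N, (j < p)%N &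
    ((mu * p)%N%:Z %| i%:Z * p%:Z - j%:Z * r - n)%Z].
Proof.
move=> pp mu0 pr; have p0 := prime_gt0 pp.
have co : coprimez r p.
  by rewrite coprimezE coprime_sym prime_coprime // -[p]/(`|p%:Z|%N) -dvdzE.
have [[u w] uw] := coprimezP _ _ co.
rewrite /= in uw.
have [j jp [q jq]] : exists2 j : nat, (j < p)%N &
    exists q : int, n + j%:Z * r = q * p%:Z.
  exists `|((- (u * n)) %% p)%Z|%N.
    by rewrite -ltz_nat gez0_abs ?modz_ge0 ?ltz_pmod; lia.
  rewrite gez0_abs ?modz_ge0; try lia.
  have := divz_eq (- (u * n)) p; set y := (_ %% _)%Z; set x := (_ %/ _)%Z.
  move=> E; exists (w * n - x * r).
  have -> : y = - (u * n) - x * p by rewrite E addrC addKr.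
  have -> : n + (- (u * n) - x * p%:Z) * r = n * (1 - u * r) - x * p%:Z * r by ring.
  by rewrite -uw; ring.
exists `|(q %% mu)%Z|%N, j; split=> //.
  by rewrite -ltz_nat gez0_abs ?modz_ge0 ?ltz_pmod; lia.
rewrite gez0_abs ?modz_ge0; try lia.
apply/dvdzP; exists (- (q %/ mu)%Z).
have -> : (q %% mu)%Z = q - (q %/ mu)%Z * mu by rewrite {2}(divz_eq q mu) addrC addKr.
have -> : n = q * p%:Z - j%:Z * r by rewrite -jq addrK.
rewrite PoszM; ring.
Qed.

Section DifferenceOperator.

Definition difference (U : zmodType) (f : U -> U) (x : U) : U := f x - x.

Lemma difference_iter_sum (U : zmodType) (f : {additive U -> U}) l
    (I : Type) (s : seq I) (P : pred I) (F : I -> U) :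
  iter l (difference f) (\sum_(i <- s | P i) F i)
  = \sum_(i <- s | P i) iter l (difference f) (F i).
Proof.
elim: l => //= l ->; rewrite /difference raddf_sum -sumrB.
by [].
Qed.

Lemma difference_iter0 (U : zmodType) (f : {additive U -> U}) l :
  iter l (difference f) 0 = 0.
Proof. by elim: l => //= l ->; rewrite /difference raddf0 subr0. Qed.

Lemma difference_iter_morph (R U : zmodType) (g : U -> U)
    (phi : R -> R) (psi : R -> U) l x :
    (forall y y', psi (y - y') = psi y - psi y') ->
    (forall y, psi (phi y) = g (psi y)) ->
  psi (iter l (difference phi) x) = iter l (difference g) (psi x).
Proof.
move=> psiB psi_g; elim: l => //= l <-.
by rewrite /difference psiB psi_g.
Qed.

Variables (A : comNzRingType) (phi : {rmorphism A -> A}).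

Lemma difference_iterM c x l : phi c = c ->
  iter l (difference phi) (c * x) = c * iter l (difference phi) x.
Proof.
move=> phic; elim: l => //= l ->.
by rewrite /difference rmorphM phic mulrBr.
Qed.

Variables (b : A) (n : nat).
Hypothesis phib : phi b = b + n%:R.

(** One difference turns b^j into a polynomial in b of degree j - 1 with leading coefficient j n.
    The shift [n] is general because sigma shifts beta by different amounts on different components
    of L. *)
Lemma difference_iterX j :
  iter j (difference phi) (b ^+ j) = (n ^ j * j`!)%:R /\
  forall l, (j < l)%N -> iter l (difference phi) (b ^+ j) = 0.
Proof.
elim/ltn_ind: j => -[|j] IH.
  split=> // -[//|l] _; rewrite iterSr /difference rmorph1 subrr.
  exact: difference_iter0.
have D1 : difference phi (b ^+ j.+1) =
    \sum_(i < j.+1) (n ^ (j.+1 - i) * 'C(j.+1, i))%:R * b ^+ i.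
  rewrite /difference rmorphXn /= phib [b + _]addrC exprDn big_ord_recr /=.
  rewrite subnn expr0 mul1r binn mulr1n addrK.
  by apply: eq_bigr => i _; rewrite natrM natrX mulrAC mulr_natr.
have phin m : phi m%:R = m%:R by rewrite rmorph_nat.
have expand l : iter l.+1 (difference phi) (b ^+ j.+1) =
   \sum_(i < j.+1) (n ^ (j.+1 - i) * 'C(j.+1, i))%:R *
      iter l (difference phi) (b ^+ i).
  rewrite iterSr D1 difference_iter_sum; apply: eq_bigr => i _.
  by rewrite difference_iterM.
split=> [|[//|l]]; last first.
  rewrite ltnS => jl; rewrite expand big1 // => i _.
  have [_ ->] := IH i (ltn_ord i); first by rewrite mulr0.
  exact: leq_trans (ltn_ord i) jl.
rewrite expand big_ord_recr /= big1 ?add0r => [|i _]; last first.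
  by have [_ ->] := IH i (ltnW (ltn_ord _)); rewrite ?mulr0.
have [-> _] := IH j (ltnSn j); rewrite -natrM subSnn expn1 binSn factS expnS.
congr (_%:R); ring.
Qed.

End DifferenceOperator.

(** * Artin-Schreier extensions of k((t^(1/m))) *)

Lemma aut_root (F0 : fieldType) (L : fieldExtType F0) (F : {subfield L})
    (phi : {lrmorphism L -> L}) (q : {poly L}) x :
    (forall y, y \in F -> phi y = y) -> q \is a polyOver F ->
  root q x -> root q (phi x).
Proof.
move=> phiF /polyOverP qF /rootP qx.
have {1}-> : q = map_poly phi q.
  by apply/polyP => i; rewrite coef_map /= phiF.
by rewrite /root horner_map qx rmorph0.
Qed.

Lemma aut_root_iter (F0 : fieldType) (L : fieldExtType F0) (F : {subfield L})
    (phi : {lrmorphism L -> L}) (q : {poly L}) x i :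
    (forall y, y \in F -> phi y = y) -> q \is a polyOver F ->
  root q x -> root q (iter i phi x).
Proof. by move=> phiF qF qx; elim: i => //= i; apply: aut_root phiF qF. Qed.

(** The n distinct iterates of x are roots of its minimal polynomial over F. *)
Lemma adjoin_degree_ge (F0 : fieldType) (L : fieldExtType F0)
    (F : {subfield L}) (phi : {lrmorphism L -> L}) x n :
    (forall y, y \in F -> phi y = y) ->
    {in [pred i | i < n]%N &, injective (fun i => iter i phi x)} ->
  (n <= adjoin_degree F x)%N.
Proof.
move=> phiF inj; rewrite -ltnS -size_minPoly.
rewrite -{1}(size_iota 0 n) -(size_map (fun i => iter i phi x)).
apply: max_poly_roots; first exact/monic_neq0/monic_minPoly.
  apply/allP => _ /mapP [i _ ->].
  exact: aut_root_iter phiF (minPolyOver F x) (root_minPoly F x).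
rewrite map_inj_in_uniq ?iota_uniq // => i j.
by rewrite !mem_iota !add0n => *; apply: inj.
Qed.

Lemma adjoin_degree_le (F0 : fieldType) (L : fieldExtType F0)
    (F : {subfield L}) (q : {poly L}) x n :
  q != 0 -> q \is a polyOver F -> root q x -> (size q <= n.+1)%N ->
  (adjoin_degree F x <= n)%N.
Proof.
move=> q0 qF qx qn; rewrite -ltnS -size_minPoly; apply: leq_trans qn.
by apply: dvdp_leq => //; apply: minPoly_dvdp.
Qed.

Lemma prime_ndvd_fact p n : prime p -> (n < p)%N -> ~~ (p %| n`!)%N.
Proof.
move=> pp; elim: n => [|n IH] ltnp; first by rewrite gtnNdvd ?prime_gt1.
by rewrite factS Euclid_dvdM // negb_or IH ?(ltnW ltnp) // andbT gtnNdvd.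
Qed.

Lemma pchar_laurent (k : fieldType) (A : algType (laurent k)) (p : nat) :
  p \in [pchar k] -> p \in [pchar A].
Proof.
move=> pk; have := rmorph_pchar (@constK k) pk.
by move/(rmorph_pchar (in_alg A)).
Qed.

Lemma shift_itv (a b c e : int) :
  - a + b <= c < - a + b + e -> 0 <= c + a - b < e.
Proof. by move=> /andP[]; lia. Qed.

(** What [Delta_datum] says about E alone, freed of the group: S and T stand for the actions of
    sigma and tau_gamma, z for the root of unity of order m_gamma. *)
Record artin_schreier (k : closedFieldType) (E : fieldExtType (laurent k))
    (v : E -> int) (p mu delta : nat) (z : k) (r : int) (S T : E -> E)
    (alpha beta : E) : Prop := ArtinSchreier {
  as_val : is_normalised_valuation v;
  as_pchar : p \in [pchar k];
  as_mu_gt0 : (0 < mu)%N;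
  as_coprime : coprime delta mu;
  as_prim : mu.-primitive_root z;
  as_root : alpha ^+ mu = (tK k)%:A;
  as_beta : beta ^+ p - beta \in <<1; alpha>>%VS;
  as_gen : <<<<1; alpha>>; beta>>%VS = fullv;
  as_S_alpha : S alpha = alpha;
  as_S_beta : S beta = beta + 1;
  as_T_alpha : T alpha = constK (z ^+ delta) *: alpha;
  as_T_beta : T beta = constK (z ^ (- (delta%:Z * r))) *: beta;
  as_v_beta : v beta = - r;
  as_jump : is_ramification_jump v S r
}.

Section ArtinSchreier.
Variables (k : closedFieldType) (E : fieldExtType (laurent k)) (v : E -> int).
Variables (p mu delta : nat) (z : k) (r : int).
Variables (S T : {lrmorphism E -> E}) (alpha beta : E).
Hypothesis ext : artin_schreier v p mu delta z r S T alpha beta.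

Let hv := as_val ext.
Let hp := as_pchar ext.
Let mu_gt0 := as_mu_gt0 ext.
Let co_delta := as_coprime ext.
Let hz := as_prim ext.
Let alpha_root := as_root ext.
Let beta_AS := as_beta ext.
Let gen := as_gen ext.
Let S_alpha := as_S_alpha ext.
Let S_beta := as_S_beta ext.
Let T_alpha := as_T_alpha ext.
Let T_beta := as_T_beta ext.
Let v_beta := as_v_beta ext.

Let pp : prime p. Proof. exact: pcharf_prime hp. Qed.
Let p0 : (0 < p)%N. Proof. exact: prime_gt0. Qed.
Let pE : p \in [pchar E]. Proof. exact: pchar_laurent. Qed.
Let mup0 : (0 < mu * p)%N. Proof. by rewrite muln_gt0 mu_gt0. Qed.

Let alpha_neq0 : alpha != 0.
Proof.
have := tE_neq0 E; rewrite -alpha_root; apply: contraNneq => ->.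
by rewrite expr0n gtn_eqF.
Qed.

Let beta_neq0 : beta != 0.
Proof.
apply: contra_eq_neq S_beta => ->; rewrite rmorph0 add0r eq_sym.
exact: oner_neq0.
Qed.

Let S_Kalpha y : y \in <<1; alpha>>%VS -> S y = y.
Proof.
move=> /Fadjoin_polyP [q /polyOver1P [q' ->] ->].
rewrite -horner_map /= S_alpha -map_poly_comp; congr (_.[_]).
by apply: eq_map_poly => c /=; rewrite linearZ /= rmorph1.
Qed.

(** The polynomials X^mu - t and X^p - X - c bound the two degrees from above. The orbits of alpha
    under T and of beta under S bound them from below; the first has [mu] elements because delta is
    prime to [mu]. *)
Lemma dim_artin_schreier : \dim {:E} = (mu * p)%N.
Proof.
rewrite -gen dim_Fadjoin dim_Fadjoin dimv1 muln1 mulnC; congr (_ * _)%N.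
  apply/eqP; rewrite eqn_leq; apply/andP; split.
    apply: (@adjoin_degree_le _ _ _ ('X^mu - ((tK k)%:A)%:P)).
    - by rewrite -size_poly_gt0 size_XnsubC.
    - by rewrite rpredB ?rpredX ?polyOverX // polyOverC memvZ ?mem1v.
    - by rewrite /root !hornerE alpha_root subrr.
    - by rewrite size_XnsubC.
  have iterT i : iter i T alpha = constK (z ^+ delta ^+ i) *: alpha.
    elim: i => [|i IH]; first by rewrite expr0 rmorph1 scale1r.
    by rewrite iterS IH linearZ /= T_alpha scalerA -rmorphM -exprSr.
  apply: (@adjoin_degree_ge _ _ _ T) => [y /vlineP [c ->]|i j].
    by rewrite linearZ /= rmorph1.
  rewrite !inE !iterT => ilt jlt /eqP.
  rewrite -subr_eq0 -scalerBl scaler_eq0 (negPf alpha_neq0) orbF subr_eq0.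
  move=> /eqP/fmorph_inj/eqP.
  have zP : mu.-primitive_root (z ^+ delta) by rewrite prim_root_exp_coprime.
  by rewrite (eq_prim_root_expr zP) !modn_small // => /eqP.
apply/eqP; rewrite eqn_leq; apply/andP; split.
  set c := beta ^+ p - beta.
  have szq : size ('X^p - ('X + c%:P)) = p.+1.
    by rewrite size_polyDl ?size_polyXn // size_polyN size_XaddC ltnS prime_gt1.
  apply: (@adjoin_degree_le _ _ _ ('X^p - ('X + c%:P))).
  - by rewrite -size_poly_gt0 szq.
  - by rewrite rpredB ?rpredX ?rpredD ?polyOverX // polyOverC.
  - rewrite /root hornerD hornerN hornerXn hornerD hornerX hornerC.
    by rewrite [beta + _]addrC subrK subrr.
  - by rewrite szq.
have iterS_beta i : iter i S beta = beta + i%:R.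
  elim: i => [|i IH]; first by rewrite addr0.
  by rewrite iterS IH rmorphD /= S_beta rmorph_nat -addrA -mulrS.
apply: (@adjoin_degree_ge _ _ _ S) => // i j.
rewrite !inE !iterS_beta => ilt jlt /addrI.
wlog ij : i j ilt jlt / (i <= j)%N.
  by move=> W eqij; case/orP: (leq_total i j) => le; [|symmetry]; apply: W.
move=> /eqP; rewrite eq_sym -subr_eq0 -natrB // -(dvdn_pcharf pE) => dv.
apply/eqP; rewrite eqn_leq ij -subn_eq0 eqn0Ngt; apply/negP => ji0.
by have := dvdn_leq ji0 dv; rewrite leqNgt (leq_ltn_trans (leq_subr _ _) jlt).
Qed.

Lemma ramif_artin_schreier : ramif v = (mu * p)%N.
Proof. by rewrite (ramif_dim hv) dim_artin_schreier. Qed.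

Lemma val_alpha : v alpha = p%:Z.
Proof.
have := val_t hv; rewrite -alpha_root (valuX hv) // ramif_artin_schreier PoszM.
by apply: mulfI; rewrite eqz_nat -lt0n.
Qed.

(** S preserves values, so S pi - pi stays in the maximal ideal. *)
Lemma jump_ge0 : 0 <= r.
Proof.
have [pi [_ val_pi S_pi jump]] := as_jump ext.
have d0 : S pi - pi != 0 by rewrite subr_eq0.
have : vge v (S pi - pi) 1.
  by apply: (vgeB hv); [apply: (vge_aut hv)|]; right; rewrite ?val_pi.
by move=> /(vgeP _ _ d0); rewrite jump lerDr.
Qed.

Lemma jump_prime_to_p : ~~ (p %| r)%Z.
Proof.
have [pi [pi_neq0 val_pi _ jump]] := as_jump ext.
apply: (jump_coprime hv pi_neq0 val_pi _ pE jump_ge0 S_beta v_beta).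
by right; rewrite jump.
Qed.

(** The least power of t that makes alpha^i beta^j integral, which is how the ceiling of the formula
    arises. *)
Definition omega_exp (i j : nat) : int :=
  Num.ceil ((- i%:Z * v alpha - j%:Z * v beta)%:~R / (mu * p)%:R : rat).

Definition omega (i j : nat) : E :=
  (tK k ^ omega_exp i j) *: (alpha ^+ i * beta ^+ j).

Lemma omega_neq0 i j : omega i j != 0.
Proof.
by rewrite scaler_eq0 negb_or expfz_neq0 ?tK_neq0 // mulf_neq0 ?expf_neq0.
Qed.

Lemma tKz_scale n : (tK k ^ n)%:A = ((tK k)%:A : E) ^ n.
Proof. by rewrite -!/(in_alg E _) fmorphXz. Qed.

Lemma val_scale_t n x : x != 0 ->
  v ((tK k ^ n) *: x) = n * (mu * p)%N%:Z + v x.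
Proof.
move=> x0; rewrite -mulr_algl tKz_scale (valuM hv) ?expfz_neq0 ?tE_neq0 //.
by rewrite (valuXz hv) ?tE_neq0 // (val_t hv) ramif_artin_schreier.
Qed.

Lemma val_alpha_beta i j : v (alpha ^+ i * beta ^+ j) = i%:Z * p%:Z - j%:Z * r.
Proof.
rewrite (valuM hv) ?expf_neq0 // !(valuX hv) // val_alpha v_beta.
by rewrite mulrN.
Qed.

Lemma val_omega i j :
  v (omega i j) = omega_exp i j * (mu * p)%N%:Z + i%:Z * p%:Z - j%:Z * r.
Proof.
by rewrite val_scale_t ?mulf_neq0 ?expf_neq0 // val_alpha_beta addrA.
Qed.

Lemma val_omega_itv i j : 0 <= v (omega i j) < (mu * p)%N%:Z.
Proof.
have := ceil_divP (- i%:Z * v alpha - j%:Z * v beta) mup0.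
rewrite -/(omega_exp i j) val_omega val_alpha v_beta.
by rewrite mulNr mulrN opprK; apply: shift_itv.
Qed.

Lemma integers_omega i j : integers (omega i j).
Proof.
apply/(integersE hv); right.
by have /andP[] := val_omega_itv i j.
Qed.

Lemma omega_val n : (n < mu * p)%N ->
  exists i j : nat, [/\ (i < mu)%N, (j < p)%N & v (omega i j) = n%:Z].
Proof.
move=> ltn; have [i [j [ilt jlt dv]]] := residue_pair n pp mu_gt0 jump_prime_to_p.
exists i, j; split=> //; have /andP[ge0 lt] := val_omega_itv i j.
have : (v (omega i j) == n%:Z %[mod (mu * p)%N])%Z.
  rewrite eqz_mod_dvd val_omega.
  have -> : omega_exp i j * (mu * p)%N%:Z + i%:Z * p%:Z - j%:Z * r - n%:Z =
    omega_exp i j * (mu * p)%N%:Z + (i%:Z * p%:Z - j%:Z * r - n%:Z) by ring.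
  by rewrite rpredD ?dvdz_mull.
by rewrite !modz_small ?ge0 // => /eqP.
Qed.

Lemma T_omega i j :
  T (omega i j) = constK (z ^ (delta%:Z * (i%:Z - r * j%:Z))) *: omega i j.
Proof.
have z0 : z != 0.
  by apply/eqP => z0; have /eqP := prim_expr_order hz;
    rewrite z0 expr0n gtn_eqF // eq_sym oner_eq0.
have -> : constK (z ^ (delta%:Z * (i%:Z - r * j%:Z))) =
    constK (z ^+ delta) ^+ i * constK (z ^ (- (delta%:Z * r))) ^+ j.
  rewrite -!rmorphXn -rmorphM /= !exprnP !exprz_exp.
  by rewrite -expfzDr //; congr (constK (z ^ _)); ring.
rewrite /omega linearZ /= rmorphM !rmorphXn /= T_alpha T_beta !exprZn.
rewrite -scalerAl -scalerAr !scalerA; congr (_ *: _).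
by rewrite [constK (z ^+ _)]rmorphXn /= -mulrA mulrC.
Qed.

Lemma prim_exp_cond (i j s : nat) :
  (z ^ (delta%:Z * (i%:Z - r * j%:Z)) == z ^+ s)
  = (delta%:Z * (i%:Z - r * j%:Z) == s %[mod mu])%Z.
Proof. by rewrite -[z ^+ s]/(z ^ s%:Z) (prim_expz_eq _ _ mu_gt0 hz). Qed.

Lemma difference_omega (phi : {lrmorphism E -> E}) (b i j : nat) :
    phi alpha = alpha -> phi beta = beta + b%:R ->
  iter j (difference phi) (omega i j) =
    (tK k ^ omega_exp i j * (b ^ j * j`!)%:R) *: alpha ^+ i /\
  forall l, (j < l)%N -> iter l (difference phi) (omega i j) = 0.
Proof.
move=> phia phib; have [D1 D0] := difference_iterX phib j.
have omegaE : omega i j = ((tK k ^ omega_exp i j) *: alpha ^+ i) * beta ^+ j.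
  by rewrite /omega scalerAl.
have fixed : phi ((tK k ^ omega_exp i j) *: alpha ^+ i) =
    (tK k ^ omega_exp i j) *: alpha ^+ i by rewrite linearZ rmorphXn /= phia.
split=> [|l jl]; rewrite omegaE difference_iterM //.
  by rewrite D1 -scalerA scaler_nat mulr_natr scalerMnr.
by rewrite D0 ?mulr0.
Qed.

Section Invariants.
Variables (s d : nat) (row : 'I_d -> 'I_mu).
Hypothesis le_dp : (d <= p)%N.
Hypothesis rowP : forall (i : 'I_mu) (j : 'I_d),
  (delta%:Z * (i%:Z - r * j%:Z) == s %[mod mu])%Z -> i = row j.

(* The omega_ij have the valuations 0, ..., e - 1, hence form a basis of the
   ring of integers over k[[t]]; they are eigenvectors of T, and S - 1 lowers
   the degree in beta, so the two conditions can be read off coefficients. *)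
Lemma invariant_expansion x :
    vge v x 0 -> T x = constK (z ^+ s) *: x -> iter d (difference S) x = 0 ->
  exists a : 'I_d -> fps k,
    x = \sum_(j < d) fps_in E (a j) * omega (row j) j.
Proof.
move=> vx Tx Dx; have eE := ramif_artin_schreier.
(* The basis is reindexed by its values, the form that [integral_expansion] asks for. *)
pose has_val n (ij : nat * nat) := (n < mu * p)%N ->
  [/\ (ij.1 < mu)%N, (ij.2 < p)%N & v (omega ij.1 ij.2) = n%:Z].
have [c cP] : {c & forall n, has_val n (c n)}.
  apply: choice => n; have [lt|ge] := ltnP n (mu * p); last first.
    by exists (0, 0)%N; rewrite /has_val ltnNge ge.
  by have [i [j ?]] := omega_val lt; exists (i, j).
pose w n := omega (c n).1 (c n).2.
have [a xa] : exists a : nat -> fps k,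
    x = \sum_(n < mu * p) fps_in E (a n) * w n.
  have [||a] := @integral_expansion _ _ _ hv w _ _ x vx.
  - by move=> n _; apply: omega_neq0.
  - by move=> n; rewrite eE => /cP [].
  by rewrite eE => xa; exists a.
have xaK : x = \sum_(n < mu * p) (FracField.tofrac (a n)) *: w n.
  by rewrite xa; apply: eq_bigr => n _; rewrite mulr_algl.
have wfree (u : 'I_(mu * p) -> laurent k) :
    \sum_n u n *: w n = 0 -> forall n, u n = 0.
  apply: (distinct_val_free hv) => [n|n n']; first exact: omega_neq0.
  have [[_ _ vn] [_ _ vn']] := (cP n (ltn_ord n), cP n' (ltn_ord n')).
  rewrite -/(w n) -/(w n') in vn vn'; rewrite vn vn' eE.
  by rewrite !modz_nat !modn_small // => -[]; apply: val_inj.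
have eigen (n : 'I_(mu * p)) : a n != 0 ->
    (delta%:Z * ((c n).1%:Z - r * (c n).2%:Z) == s %[mod mu])%Z.
  move=> an0; rewrite -prim_exp_cond.
  pose lam n := z ^ (delta%:Z * ((c n).1%:Z - r * (c n).2%:Z)).
  have Tw i f : T (f *: w i) = f *: (constK (lam i) *: w i).
    by rewrite -T_omega linearZ.
  (* These are the coefficients of T x - z^s x = 0 in the free family [w]. *)
  have := wfree (fun n => FracField.tofrac (a n) * constK (lam n - z ^+ s)) _ n.
  move=> /(_ _)/eqP; rewrite mulf_eq0 tofrac_eq0 (negPf an0) fmorph_eq0 subr_eq0.
  apply; rewrite -[RHS](subrr (T x)) {2}Tx {1}xaK {1}xaK linear_sum scaler_sumr.
  rewrite -sumrB; apply: eq_bigr => n' _; rewrite /= Tw !scalerA.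
  rewrite -scalerBl rmorphB mulrBr mulrBl.
  by rewrite [constK (z ^+ s) * _]mulrC.
have deg (n : 'I_(mu * p)) : a n != 0 -> ((c n).2 < d)%N.
  move=> an0; rewrite ltnNge; apply/negP => dn.
  (* Let J be the largest degree in beta that occurs. Applying S - 1 J times kills the terms of
     lower degree and replaces beta^J by J!, which is invertible as J < p; so J >= d contradicts the
     vanishing of the d-th difference. *)
  case: (@arg_maxnP _ n (fun n => a n != 0) (fun n => (c n).2) an0) => m am max.
  have dJ := leq_trans dn (max n an0); set J := (c m).2 in max dJ.
  have DJx : iter J (difference S) x = 0.
    by rewrite -(subnK dJ) iterD Dx difference_iter0.
  have Jp : (J < p)%N by have [] := cP m (ltn_ord m).
  have S_beta1 : S beta = beta + 1%:R by [].
  have := wfree (fun n => FracField.tofrac (a n) * (J`!)%:R *+ ((c n).2 == J)) _ m.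
  move=> /(_ _)/eqP; rewrite eqxx mulr1n mulf_eq0 tofrac_eq0 (negPf am) /=.
  rewrite -(dvdn_pcharf (pchar_laurent (laurent k)^o hp)).
  have -> : (p %| J`!)%N = false.
    exact/negbTE/prime_ndvd_fact.
  move=> sum_neq0; suff : false by []; apply: sum_neq0.
  (* Multiplying back by beta^J turns the surviving terms into multiples of the [w n], to which
     freeness applies. *)
  transitivity (iter J (difference S) x * beta ^+ J); last by rewrite DJx mul0r.
  rewrite xa difference_iter_sum mulr_suml.
  apply: eq_bigr => n' _.
  rewrite difference_iterM; last exact: aut_fps.
  have [D1 D0] := difference_omega (c n').1 (c n').2 S_alpha S_beta1.
  have [eqJ|neqJ] := eqVneq (c n').2 J.
    rewrite mulr1n -{2}eqJ /w D1 exp1n mul1n /omega eqJ.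
    rewrite /fps_in mulr_algl -!scalerAl !scalerA; congr (_ *: _).
    by rewrite -mulrA; congr (_ * _); apply: mulrC.
  rewrite mulr0n scale0r.
  have [->|an'] := eqVneq (a n') 0; first by rewrite rmorph0 !mul0r.
  rewrite D0 ?mulr0 ?mul0r // ltn_neqAle neqJ; exact: max.
(* Every nonzero summand belongs to the pair (row j, j), by [eigen] and [rowP]; summing avoids
   selecting its index. *)
pose a' (j : 'I_d) := \sum_(n < mu * p | (c n).2 == j) a n; exists a'.
rewrite {1}xa; under [RHS]eq_bigr do rewrite rmorph_sum mulr_suml.
rewrite (exchange_big_dep predT) //=; apply: eq_bigr => n _.
have [an|an] := eqVneq (a n) 0.
  by rewrite an rmorph0 mul0r big1 // => j _; rewrite mul0r.
rewrite (big_pred1 (Ordinal (deg n an))) => [|j]; last by rewrite eq_sym.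
have [ilt _ _] := cP n (ltn_ord n).
have := @rowP (Ordinal ilt) (Ordinal (deg n an)) (eigen n an).
by move=> /(congr1 val) /= <-.
Qed.

End Invariants.
End ArtinSchreier.

(** * Lattices spanned by triangular matrices *)

Section Components.
Variables (k : closedFieldType) (E : fieldExtType (laurent k)) (v : E -> int).
Hypothesis hv : is_normalised_valuation v.
Variables (L : comAlgType (laurent k)) (g : nat).
Variable psi : 'I_g -> {lrmorphism L -> E}.
Hypothesis psi_inj : forall x, (forall n, psi n x = 0) -> x = 0.
Hypothesis psi_surj : forall f : 'I_g -> E, exists x, forall n, psi n x = f n.

Lemma psi_eq x y : (forall n, psi n x = psi n y) -> x = y.
Proof.
move=> eqxy; apply/eqP; rewrite -subr_eq0; apply/eqP/psi_inj => n.
by rewrite rmorphB /= eqxy subrr.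
Qed.

Lemma psi_fps n f x : psi n (fps_in L f * x) = fps_in E f * psi n x.
Proof. by rewrite rmorphM /= /fps_in linearZ rmorph1. Qed.

Lemma map_fps_in n q : map_poly (fps_in E) q = map_poly (psi n) (map_poly (fps_in L) q).
Proof.
rewrite -map_poly_comp; apply: eq_map_poly => f /=.
by rewrite /fps_in linearZ rmorph1.
Qed.

(** For the converse, the product of monic equations of the components is a monic equation that
    holds in every component. *)
Lemma integers_components x :
  integers x <-> forall n, vge v (psi n x) 0.
Proof.
split=> [ix n|vx]; first exact/(integersE hv)/integers_rmorph.
have root_psi n : exists q : {poly fps k}, q \is monic /\
    (map_poly (fps_in E) q).[psi n x] = 0.
  by have /(integersE hv) [q qmon /rootP qx] := vx n; exists q.
have [q qP] := choice root_psi.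
exists (\prod_n q n); first by apply: monic_prod => n _; case: (qP n).
apply/rootP/psi_inj => n; rewrite -horner_map /= -map_fps_in rmorph_prod.
rewrite horner_prod (bigD1 n) //=; case: (qP n) => _ ->.
by rewrite mul0r.
Qed.

Section Triangular.
Variables (d : nat) (W : 'I_d -> 'rV[L]_d) (D : 'I_d -> nat).
Hypothesis W_int : forall j l, integers (W j 0 l).
Hypothesis W_tri : forall j l : 'I_d, (j < l)%N -> W j 0 l = 0.
Hypothesis W_diag_neq0 : forall j n, psi n (W j 0 j) != 0.
Hypothesis W_diag : forall j n, v (psi n (W j 0 j)) = D j.

Let scal (f : fps k) (x : 'rV[L]_d) := fps_in L f *: x.

Lemma diag_mul_eq0 x j : x * W j 0 j = 0 -> x = 0.
Proof.
move=> xW; apply: psi_inj => n; move: xW => /(congr1 (psi n)).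
rewrite rmorphM rmorph0 => /eqP; rewrite mulf_eq0 (negPf (W_diag_neq0 j n)).
by rewrite orbF => /eqP.
Qed.

(** At the largest j with [a j] nonzero, column j meets only the diagonal entry, which is not a zero
    divisor since none of its components vanishes. *)
Lemma triangular_inj (q : nat) (a : 'I_d -> L) :
    (forall l : 'I_d, (q <= l)%N ->
       (\sum_(j < d | (q <= j)%N) a j *: W j) 0 l = 0) ->
  forall j : 'I_d, (q <= j)%N -> a j = 0.
Proof.
move=> sum0 j0 qj0; apply/eqP; apply: contrapT => /negP aj0.
have Pj0 : (q <= j0)%N && (a j0 != 0) by rewrite qj0.
case: (@arg_maxnP _ j0 (fun j : 'I_d => (q <= j)%N && (a j != 0)) val Pj0).
move=> j /andP[qj aj] max; case/eqP: aj.
apply: (@diag_mul_eq0 _ j); have := sum0 j qj.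
rewrite summxE (bigD1 j) //= mxE big1 ?addr0 // => i /andP[qi ij]; rewrite mxE.
have [ltij|leji] := ltnP i j; first by rewrite W_tri // mulr0.
have [->|ai] := eqVneq (a i) 0; first by rewrite mul0r.
have leij : (i <= j)%N by apply: max; rewrite qi.
by case/negP: ij; rewrite -val_eqE eqn_leq /= leij.
Qed.

(* The series from the span of the rows to the full lattice replaces W q by the
   q-th unit vector, one q at a time, in steps of one unit of the valuation of a
   component of W q 0 q. *)
Definition lattice (q : nat) (P : 'rV[L]_d -> Prop) : set 'rV[L]_d :=
  fun x => exists a : 'I_d -> L, (forall j, integers (a j)) /\
    P (x - \sum_(j < d | (q <= j)%N) a j *: W j).

Definition supported (q : nat) (y : 'rV[L]_d) : Prop :=
  (forall l : 'I_d, (q <= l)%N -> y 0 l = 0) /\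
  (forall l : 'I_d, (l < q)%N -> integers (y 0 l)).

(** Interpolates between two consecutive lattices: inside [lattice q.+1], the bound c = 0 gives the
    one for q + 1 ([lattice_full]) and c = D q the one for q ([lattice_diag]). *)
Definition bounded (q : 'I_d) (c : 'I_g -> nat) (y : 'rV[L]_d) : Prop :=
  [/\ forall l : 'I_d, (q < l)%N -> y 0 l = 0,
      forall l : 'I_d, (l < q)%N -> integers (y 0 l) &
      forall n, vge v (psi n (y 0 q)) (c n)].

Lemma lattice_submodule q P : is_submodule scal P ->
  is_submodule scal (lattice q P).
Proof.
case=> P0 PD PZ; split.
- exists (fun=> 0); split=> [_|]; first exact: integers0.
  by rewrite big1 ?subr0 // => j _; rewrite scale0r.
- move=> x y [a [ia Pa]] [b [ib Pb]].
  exists (fun j => a j + b j); split=> [j|]; first exact: integersD.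
  have -> : \sum_(j < d | (q <= j)%N) (a j + b j) *: W j =
      \sum_(j < d | (q <= j)%N) a j *: W j + \sum_(j < d | (q <= j)%N) b j *: W j.
    by rewrite -big_split; apply: eq_bigr => j _; rewrite scalerDl.
  by rewrite opprD addrACA; apply: PD.
- move=> f x [a [ia Pa]].
  exists (fun j => fps_in L f * a j); split=> [j|].
    by apply: integersM => //; apply: integers_fps.
  have -> : \sum_(j < d | (q <= j)%N) (fps_in L f * a j) *: W j =
      scal f (\sum_(j < d | (q <= j)%N) a j *: W j).
    by rewrite /scal scaler_sumr; apply: eq_bigr => j _; rewrite scalerA.
  by rewrite /scal -scalerBr; apply: PZ.
Qed.

Lemma bounded_submodule q c : is_submodule scal (bounded q c).
Proof.
split.
- split=> *; rewrite mxE; [by [] | exact: integers0 |].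
  by rewrite rmorph0; left.
- move=> x y [x1 x2 x3] [y1 y2 y3]; split=> l *; rewrite mxE.
  + by rewrite x1 // y1 // addr0.
  + by apply: integersD; [apply: x2 | apply: y2].
  + by rewrite rmorphD; apply: (vgeD hv); [apply: x3 | apply: y3].
- move=> f x [x1 x2 x3]; split=> l *; rewrite mxE.
  + by rewrite x1 // mulr0.
  + by apply: integersM; [apply: integers_fps | apply: x2].
  + rewrite psi_fps mulrC.
    exact: (vgeMl hv (x3 l) (lexx 0) (vge_fps hv f)).
Qed.

Definition bump_at (c : 'I_g -> nat) (n0 n : 'I_g) : nat := (c n + (n == n0))%N.

(** Raising one bound by one cuts out a copy of the residue field k, so constant scalars suffice to
    generate the quotient. *)
Lemma lattice_step (q : 'I_d) c n0 :
  simple_step scal (lattice q.+1 (bounded q (bump_at c n0)))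
    (lattice q.+1 (bounded q c)).
Proof.
have sub c' := lattice_submodule q.+1 (bounded_submodule q c').
have bumpE : bump_at c n0 n0 = (c n0).+1 by rewrite /bump_at eqxx addn1.
have bumpN n : n != n0 -> bump_at c n0 n = c n.
  by move=> nn0; rewrite /bump_at (negPf nn0) addn0.
split=> //.
  split=> [x [a [ia [x1 x2 x3]]]|].
    exists a; split=> //; split=> // n; apply: vge_le (x3 n).
    by rewrite lez_nat leq_addr.
  have [_ _ _ [pi pi0 vpi]] := hv.
  (* Witness of strictness: concentrated in coordinate [q] and component [n0], with the least value
     allowed by [c]. Rows beyond [q] cannot correct it, as [triangular_inj] makes their coefficients
     vanish. *)
  have [u uP] := psi_surj (fun n => if n == n0 then pi ^+ c n0 else 0).
  pose y : 'rV[L]_d := \row_l (if l == q then u else 0).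
  have yl (l : 'I_d) : l != q -> y 0 l = 0 by rewrite mxE => /negPf ->.
  have yq : y 0 q = u by rewrite mxE eqxx.
  move=> /(_ y) []; last first.
    move=> a [_ [y1 _ y3]].
    have a0 : forall j : 'I_d, (q < j)%N -> a j = 0.
      apply: triangular_inj => l ql.
      have := y1 l ql; rewrite [LHS]mxE yl; last first.
        by rewrite -val_eqE /= gtn_eqF.
      by rewrite mxE add0r => /eqP; rewrite oppr_eq0 => /eqP.
    have := y3 n0; rewrite big1 => [|j qj]; last by rewrite a0 ?scale0r.
    rewrite subr0 yq uP eqxx bumpE vgeP ?expf_neq0 // (valuX hv) // vpi mulr1.
    by rewrite lez_nat ltnn.
  exists (fun=> 0); split=> [_|]; first exact: integers0.
  rewrite big1 => [|j _]; last by rewrite scale0r.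
  rewrite subr0; split=> [l ql|l ql|n].
  - by rewrite yl // -val_eqE /= gtn_eqF.
  - by rewrite yl ?(ltn_eqF ql) // -?val_eqE /= ?ltn_eqF //; apply: integers0.
  - rewrite yq uP; case: eqP => [->|_]; last by left.
    by right; rewrite (valuX hv) // vpi mulr1.
move=> x y [a [ia]]; set x' := x - _ => -[x1 x2 x3].
move=> [b [ib]]; set y' := y - _ => -[y1 y2 y3] ny.
have nvy : ~ vge v (psi n0 (y' 0 q)) (c n0).+1.
  move=> vy; apply: ny; exists b; split=> //; split=> // n.
  by have [->|nn0] := eqVneq n n0; [rewrite bumpE | rewrite bumpN].
have y0 : psi n0 (y' 0 q) != 0 by apply/eqP => y0; apply: nvy; left.
have vy : v (psi n0 (y' 0 q)) = c n0.
  have /(vgeP _ _ y0) := y3 n0.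
  rewrite le_eqVlt => /predU1P[->//|lt]; case: nvy; right.
  by rewrite -addn1 PoszD lezD1.
(* The component of y' has value exactly [c n0], so the quotient is integral; subtracting its
   residue times y' raises the value at [n0]. *)
have [|r vr] := @residue _ _ _ hv (psi n0 (x' 0 q) / psi n0 (y' 0 q)).
  by have := vge_div hv y0 (x3 n0); rewrite vy subrr.
exists (fpsC r), (fun j => a j - fps_in L (fpsC r) * b j); split=> [j|].
  by apply: integersB => //; apply: integersM => //; apply: integers_fps.
have -> : x - scal (fpsC r) y -
    \sum_(j < d | (q < j)%N) (a j - fps_in L (fpsC r) * b j) *: W j =
    x' - scal (fpsC r) y'.
  rewrite /x' /y' /scal scalerBr scaler_sumr.
  rewrite (eq_bigr (fun j => a j *: W j - fps_in L (fpsC r) *: (b j *: W j))).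
    by rewrite sumrB !opprB addrACA [RHS]addrACA; congr (_ + _); apply: addrC.
  by move=> j _; rewrite scalerBl scalerA.
have coord (X Y : 'rV[L]_d) f l :
    (X - scal f Y) 0 l = X 0 l - fps_in L f * Y 0 l by rewrite !mxE.
split=> [l ql|l ql|n]; rewrite coord.
- by rewrite x1 // y1 // mulr0 subr0.
- apply: integersB; first exact: x2.
  by apply: integersM; [apply: integers_fps | apply: y2].
- rewrite rmorphB /= psi_fps.
  have [->|nn0] := eqVneq n n0; rewrite ?bumpE ?bumpN //.
    have -> : psi n0 (x' 0 q) - fps_in E (fpsC r) * psi n0 (y' 0 q) =
      psi n0 (y' 0 q) * (psi n0 (x' 0 q) / psi n0 (y' 0 q) - (constK r)%:A).
      by rewrite mulrBr mulrCA divff // mulr1 [_ * psi _ _]mulrC.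
    by rewrite -[(c n0).+1]addn1 PoszD; apply: (vgeM hv (y3 n0) vr).
  apply: (vgeB hv (x3 n)); rewrite mulrC.
  exact: (vgeMl hv (y3 n) (lexx 0) (vge_fps hv _)).
Qed.

Lemma lattice_length (q : 'I_d) c :
  comp_length scal (lattice q.+1 (bounded q c))
    (lattice q.+1 (bounded q (fun=> 0%N))) (\sum_n c n).
Proof.
move: {2}(\sum_n c n)%N (erefl (\sum_n c n)%N) => N.
elim: N c => [|N IH] c sumc.
  have -> : c = fun=> 0%N.
    apply/funext => n; apply/eqP; rewrite -leqn0 -[leqRHS]sumc.
    by rewrite (bigD1 n) //= leq_addr.
  rewrite big1 //; apply: comp_length0.
  exact/lattice_submodule/bounded_submodule.
have [n0 cn0] : exists n0, (0 < c n0)%N.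
  apply: contrapT => c0; suff : (\sum_n c n = 0)%N by rewrite sumc.
  by apply: big1 => n _; apply/eqP; rewrite -leqn0 leqNgt; apply/negP => ?;
    apply: c0; exists n.
pose c' n := (c n - (n == n0))%N.
have cE : c = bump_at c' n0.
  apply/funext => n; rewrite /bump_at /c' subnK //.
  by case: eqP => // ->.
have sumc' : (\sum_n c' n = N)%N.
  apply/succn_inj; rewrite -sumc [in RHS]cE /bump_at big_split /= -addn1.
  by congr (_ + _)%N; rewrite -big_mkcond /= big_pred1_eq.
rewrite sumc -[N.+1]add1n; apply: (@comp_length_trans _ _ _ _
  (lattice q.+1 (bounded q c'))); last by rewrite -sumc'; apply: IH.
have st := lattice_step q c' n0; rewrite -cE in st.
by apply: (comp_lengthS _ st); apply: comp_length0; case: st.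
Qed.

Lemma lattice_full (q : 'I_d) :
  lattice q.+1 (bounded q (fun=> 0%N)) = lattice q.+1 (supported q.+1).
Proof.
congr (lattice _ _); apply/funext => y; apply/propext.
split=> [[y1 y2 y3]|[y1 y2]].
  split=> // l; rewrite ltnS leq_eqVlt => /predU1P[lq|]; last exact: y2.
  by have -> : l = q; [apply: val_inj | apply/integers_components].
split=> // [l ql|n]; first by apply: y2; apply: ltnW.
by move: n; apply/integers_components/y2.
Qed.

(** The bound [D q] is the value of every component of the diagonal entry of [W q], so coordinate
    [q] is an integral multiple of that entry and can be cleared with [W q]. *)
Lemma lattice_diag (q : 'I_d) :
  lattice q.+1 (bounded q (fun=> D q)) = lattice q (supported q).
Proof.
have sumS (a : 'I_d -> L) : \sum_(j < d | (q <= j)%N) a j *: W j =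
    a q *: W q + \sum_(j < d | (q < j)%N) a j *: W j.
  rewrite (bigD1 q) //=; congr (_ + _); apply: eq_bigl => j.
  by rewrite ltn_neqAle andbC -val_eqE eq_sym.
apply/funext => x; apply/propext; split=> -[a [ia Px]]; last first.
  case: Px; rewrite sumS opprD addrCA; set y := x - _ => y1 y2.
  have yE l : y 0 l = a q * W q 0 l + (- (a q *: W q) + y) 0 l.
    by rewrite !mxE addrA subrr add0r.
  exists a; split=> //; split=> [l ql|l lq|n].
  - by rewrite yE y1 ?(ltnW ql) // W_tri // mulr0 addr0.
  - rewrite yE; apply: integersD (y2 l lq).
    by apply: integersM.
  - rewrite yE y1 // addr0 rmorphM mulrC.
    apply: (vgeMl hv _ (lexx 0)); first by right; rewrite W_diag.
    exact/(integers_components _).1.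
case: Px; set y := x - _ => y1 y2 y3.
have [u uP] := psi_surj (fun n => psi n (y 0 q) / psi n (W q 0 q)).
have iu : integers u.
  apply/integers_components => n; rewrite uP.
  have := vge_div hv (W_diag_neq0 q n) (y3 n).
  by rewrite W_diag subrr.
have uW : u * W q 0 q = y 0 q.
  by apply: psi_eq => n; rewrite rmorphM /= uP divfK.
exists (fun j => if j == q then u else a j); split=> [j|]; first by case: eqP.
rewrite sumS eqxx.
rewrite (eq_bigr (fun j => a j *: W j)) => [|j qj]; last first.
  by rewrite -val_eqE /= gtn_eqF.
rewrite opprD addrCA -/y.
have yE l : (- (u *: W q) + y) 0 l = y 0 l - u * W q 0 l by rewrite !mxE addrC.
split=> l ql; rewrite yE.
  move: ql; rewrite leq_eqVlt => /predU1P[ql|ql].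
    by have <- : q = l; [apply: val_inj | rewrite uW subrr].
  by rewrite y1 // W_tri // mulr0 subr0.
by apply: integersB; [apply: y2 | apply: integersM].
Qed.

Definition integral_span : set 'rV[L]_d :=
  fun x => exists a : 'I_d -> L,
    (forall j, integers (a j)) /\ x = \sum_j a j *: W j.

(** Passing from [q] to q + 1 costs [D q] steps for each of the g components. *)
Theorem triangular_length :
  comp_length scal integral_span (@integer_vectors k d L) (\sum_j g * D j)%N.
Proof.
have -> : integral_span = lattice 0 (supported 0).
  apply/funext => x; apply/propext; split=> -[a [ia xa]]; exists a; split=> //.
    by split=> l //; rewrite xa subrr mxE.
  by apply/rowP => l; have [/(_ l isT) + _] := xa; rewrite !mxE => /eqP;
    rewrite subr_eq0 => /eqP.
have -> : @integer_vectors k d L = lattice d (supported d).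
  apply/funext => x; apply/propext.
  have s0 (a : 'I_d -> L) : x - \sum_(j < d | (d <= j)%N) a j *: W j = x.
    by rewrite big1 ?subr0 // => j; rewrite leqNgt ltn_ord.
  split=> [ix|[a [_]]].
    exists (fun=> 0); split=> [_|]; first exact: integers0.
    by rewrite s0; split=> l; [rewrite leqNgt ltn_ord | move=> _; apply: ix].
  by rewrite s0 => -[_ x2] l; apply: x2.
suff IH q : (q <= d)%N -> comp_length scal (lattice 0 (supported 0))
    (lattice q (supported q)) (\sum_(j < d | (j < q)%N) g * D j)%N.
  rewrite -(@eq_bigl _ _ _ _ _ (fun j : 'I_d => (j < d)%N) predT) => [|j].
    exact: IH.
  exact: ltn_ord.
elim: q => [_|q IH ltqd].
  rewrite big_pred0 //; apply/comp_length0/lattice_submodule.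
  split; first by split=> *; rewrite mxE //; apply: integers0.
    move=> x y [x1 _] [y1 _]; split=> // l ql.
    by rewrite mxE x1 // y1 // addr0.
  by move=> f x [x1 _]; split=> // l ql; rewrite mxE x1 // mulr0.
rewrite (bigD1 (Ordinal ltqd)) //= addnC.
rewrite (eq_bigl (fun j : 'I_d => (j < q)%N)) => [|j]; last first.
  by rewrite -val_eqE /= ltnS ltn_neqAle andbC.
apply: comp_length_trans (IH (ltnW ltqd)) _.
have := lattice_length (Ordinal ltqd) (fun=> D (Ordinal ltqd)).
by rewrite lattice_full lattice_diag sum_nat_const card_ord.
Qed.

End Triangular.
End Components.

(** * The semidirect product and its representation *)

Lemma alg_action_lrmorphism (k : fieldType) (gT : finGroupType)
    (H : {set gT}) (A : algType (laurent k)) (act : gT -> A -> A) :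
    is_alg_action H act ->
  exists Phi : gT -> {lrmorphism A -> A},
    forall h, h \in H -> forall x, Phi h x = act h x.
Proof.
case=> morph _ _.
pose P h (phi : {lrmorphism A -> A}) := h \in H -> forall x, phi x = act h x.
suff /choice [Phi PhiP] : forall h, exists phi, P h phi by exists Phi.
move=> h; have [hH|hnH] := boolP (h \in H); last first.
  (* Outside [H] nothing is known about [act]; the identity is a placeholder. *)
  by exists (idfun : {lrmorphism A -> A}); rewrite /P (negPf hnH).
have [lin mon] := morph h hH.
pose la := GRing.isLinear.Build _ _ _ _ (act h) lin.
pose ma := GRing.isMonoidMorphism.Build _ _ (act h) mon.
by exists (HB.pack (act h) la ma : {lrmorphism A -> A}).
Qed.

Section SemidirectGroup.
Variables (gT : finGroupType) (p m a : nat) (sigma tau : gT).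
Hypothesis hG : is_semidirect_group p m a sigma tau.
Local Open Scope group_scope.

Lemma semidirect_elt (h : gT) : exists u n : nat, h = sigma ^+ u * tau ^+ n.
Proof.
case: hG => _ _ /sdprodP [_ mul _ _] _.
have : h \in <[sigma]> * <[tau]> by rewrite mul inE.
by case/mulsgP => _ _ /cycleP [u ->] /cycleP [n ->] ->; exists u, n.
Qed.

Lemma semidirect_card : #|gT| = (p * m)%N.
Proof.
case: hG => os ot /sdprod_card; rewrite -!/(order _) os ot cardsT => ->.
by [].
Qed.

Lemma tau_sigma : tau * sigma = sigma ^+ a * tau.
Proof. by case: hG => _ _ _ <-; rewrite mulgKV. Qed.

Lemma tau_sigmaX N : tau * sigma ^+ N = sigma ^+ (a * N) * tau.
Proof.
elim: N => [|N IH]; first by rewrite muln0 !expg0 mulg1 mul1g.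
by rewrite expgSr mulgA IH -mulgA tau_sigma mulgA -expgD mulnS addnC.
Qed.

Lemma tauX_sigma n : tau ^+ n * sigma = sigma ^+ (a ^ n) * tau ^+ n.
Proof.
elim: n => [|n IH]; first by rewrite expn0 !expg0 mul1g mulg1 expg1.
by rewrite expgS -mulgA IH mulgA tau_sigmaX -mulgA expnS.
Qed.

(** Otherwise the conjugate of sigma by tau would be 1. Consequently the shifts a^n of beta are
    nonzero in k. *)
Lemma semidirect_prime_ndvd : prime p -> ~~ (p %| a)%N.
Proof.
move=> pp; case: hG => os _ _ conj; apply/negP => pa.
have sa : sigma ^+ a = 1 by apply/eqP; rewrite -order_dvdn os.
have : sigma = 1.
  by have := conj; rewrite sa => /(canRL (mulgKV tau)) /(canRL (mulKg tau)) ->;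
    rewrite mul1g mulVg.
by move=> s1; have := os; rewrite s1 order1 => p1; rewrite -p1 in pp.
Qed.

Section Subgroup.
Variable gamma : nat.
Local Notation H := (H_ m gamma sigma tau).
Local Notation g := (gcdn gamma m).

Lemma sigma_in_H : sigma \in H.
Proof. by apply: mem_gen; rewrite !inE eqxx. Qed.

Lemma tau_in_H : tau_ m gamma tau \in H.
Proof. by apply: mem_gen; rewrite !inE eqxx orbT. Qed.

(** The generators have the coprime orders p and m_gamma. The divisibility lets the order of H clear
    the denominator of the formula. *)
Lemma H_card_dvd : prime p -> ~~ (p %| m)%N -> (m_ m gamma * p %| #|H|)%N.
Proof.
move=> pp pm; case: hG => os ot _ _.
have m0 : (0 < m)%N by rewrite -ot order_gt0.
have dgm : (g %| m)%N by apply: dvdn_gcdr.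
have op : (p %| #|H|)%N by rewrite -os; apply: order_dvdG sigma_in_H.
have om : (m_ m gamma %| #|H|)%N.
  have <- : #[tau_ m gamma tau] = m_ m gamma.
    by rewrite /tau_ orderXdiv ?ot.
  exact: order_dvdG tau_in_H.
rewrite Gauss_dvd ?om // coprime_sym prime_coprime //.
apply: contra pm => pmg; apply: dvdn_trans pmg _.
by apply/dvdnP; exists g; rewrite mulnC divnK.
Qed.

End Subgroup.
End SemidirectGroup.

Section Coordinates.
Variables (k : fieldType) (gT : finGroupType) (p m a : nat) (zeta : nat -> k).
Variables (sigma tau : gT) (d s : nat).
Hypothesis hG : is_semidirect_group p m a sigma tau.
Variable V : mx_representation k [set: gT]%G d.
Hypothesis hV : is_V m zeta sigma tau s V.
Variables (L : comAlgType (laurent k)) (A : gT -> {lrmorphism L -> L}).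
Hypothesis A1 : forall x, A 1%g x = x.
Hypothesis AM : forall g h x, A (g * h)%g x = A g (A h x).
Variable c : 'rV[L]_d.

(** Evaluates at [c] the linear form given by column [j] of [N], following the column convention of
    [is_V]. *)
Definition comb (N : 'M[k]_d) (j : 'I_d) : L :=
  \sum_i constK (N i j) *: c 0 i.

Definition equivariant (h : gT) : Prop := forall j, A h (c 0 j) = comb (V h) j.

Lemma combM N N' j : comb (N *m N') j = \sum_l constK (N' l j) *: comb N l.
Proof.
rewrite /comb; under [RHS]eq_bigr do rewrite scaler_sumr.
rewrite exchange_big; apply: eq_bigr => i _; rewrite mxE rmorph_sum scaler_suml.
by apply: eq_bigr => l _; rewrite scalerA rmorphM mulrC.
Qed.

Lemma act_comb h N j : equivariant h -> A h (comb N j) = comb (V h *m N) j.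
Proof.
move=> eh; rewrite combM linear_sum; apply: eq_bigr => i _ /=.
by rewrite linearZ /= eh.
Qed.

Lemma equivariantM g h : equivariant g -> equivariant h -> equivariant (g * h)%g.
Proof.
by move=> eg eh j; rewrite AM eh (act_comb _ _ eg) repr_mxM ?inE.
Qed.

Lemma equivariant1 : equivariant 1%g.
Proof.
move=> j; rewrite A1 repr_mx1 /comb (bigD1 j) //= mxE eqxx rmorph1 scale1r.
by rewrite big1 ?addr0 // => i ij; rewrite mxE (negPf ij) rmorph0 scale0r.
Qed.

Lemma equivariantX g n : equivariant g -> equivariant (g ^+ n)%g.
Proof.
move=> eg; elim: n => [|n IH]; first by rewrite expg0; apply: equivariant1.
by rewrite expgS; apply: equivariantM.
Qed.

(* [x_j] with the convention [x_d = 0]. *)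
Definition entry (j : nat) : L := \sum_(i : 'I_d | i == j :> nat) c 0 i.

Lemma entryE (j : 'I_d) : entry j = c 0 j.
Proof. exact: big_pred1_eq. Qed.

Lemma comb_sigma N j :
  comb (N *m V sigma) j = comb N j + \sum_(i : 'I_d | i == j.+1 :> nat) comb N i.
Proof.
rewrite combM (eq_bigr (fun l : 'I_d => (l == j)%:R *: comb N l +
   (l == j.+1 :> nat)%:R *: comb N l)) => [|l _]; last first.
  by rewrite (hV.1 l j) rmorphD !rmorph_nat scalerDl.
rewrite big_split /= (bigD1 j) //= eqxx scale1r big1 ?addr0 => [|l /negPf ->].
  congr (_ + _); rewrite [RHS]big_mkcond; apply: eq_bigr => l _.
  by case: eqP; rewrite ?scale1r ?scale0r.
by rewrite scale0r.
Qed.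

Lemma comb1 j : comb 1%:M j = c 0 j.
Proof. by rewrite -[RHS]A1 equivariant1 repr_mx1. Qed.

Lemma equivariant_sigma :
  equivariant sigma <-> forall j : 'I_d, difference (A sigma) (c 0 j) = entry j.+1.
Proof.
have sE (j : 'I_d) : comb (V sigma) j = c 0 j + entry j.+1.
  rewrite -[V sigma]mul1mx comb_sigma comb1; congr (_ + _).
  by apply: eq_bigr => i _; rewrite comb1.
split=> es j; first by rewrite /difference es sE addrC addKr.
by rewrite sE -es /difference addrC subrK.
Qed.

(** [is_V] prescribes tau on the first coordinate only. The others follow by induction from x_(j+1)
    = (sigma - 1) x_j and tau sigma = sigma^a tau, used both for the action on L and for V. *)
Lemma equivariant_tau (j0 : 'I_d) : j0 = 0%N :> nat ->
    equivariant sigma -> A tau (c 0 j0) = constK (zeta m ^+ s) *: c 0 j0 ->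
  equivariant tau.
Proof.
move=> j00 es t0 [j jd]; elim: j jd => [|j IH] jd.
  have -> : Ordinal jd = j0 by apply: val_inj; rewrite /= j00.
  rewrite t0 /comb (bigD1 j0) //= (hV.2 _ _ j00) eqxx mulr1n.
  rewrite big1 ?addr0 // => i ij.
  by rewrite (hV.2 _ _ j00) (negPf ij) mulr0n rmorph0 scale0r.
have jd' := ltnW jd; set j' := Ordinal jd'; set j1 := Ordinal jd.
have one N : \sum_(i : 'I_d | i == j'.+1 :> nat) comb N i = comb N j1.
  by rewrite (big_pred1 j1) // => i; rewrite -val_eqE.
have cE : c 0 j1 = A sigma (c 0 j') - c 0 j'.
  have /equivariant_sigma/(_ j') := es; rewrite /difference => ->.
  by rewrite -entryE.
rewrite cE rmorphB /= -AM (tau_sigma hG) AM !(IH jd').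
rewrite (act_comb _ _ (equivariantX a es)) -repr_mxM ?inE // -(tau_sigma hG).
by rewrite repr_mxM ?inE // comb_sigma one addrC addKr.
Qed.

Lemma equivariant_all : equivariant sigma -> equivariant tau ->
  forall h, equivariant h.
Proof.
move=> es et h; have [u [n ->]] := semidirect_elt hG h.
by apply: equivariantM; apply: equivariantX.
Qed.

End Coordinates.

(** * Non-trivial torsors *)

Section Datum.
Variables (k : closedFieldType) (p : nat) (zeta : nat -> k).
Hypotheses (hp : p \in [pchar k]) (hzeta : is_root_system p zeta).
Variables (m : nat) (gT : finGroupType) (sigma tau : gT) (a : nat).
Hypothesis hm : ~~ (p %| m)%N.
Hypothesis hG : is_semidirect_group p m a sigma tau.
Variables (gamma s : 'I_m) (d : nat).
Hypotheses (d_gt0 : (0 < d)%N) (le_dp : (d <= p)%N).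
Variable V : mx_representation k [set: gT]%G d.
Hypothesis hV : is_V m zeta sigma tau s V.
Variables (L : comAlgType (laurent k)) (actL : gT -> L -> L).
Hypothesis hL : is_Getale actL.
Variable x : Delta_datum p zeta m sigma tau gamma actL.

Local Notation g := (gcdn gamma m).
Local Notation mu := (m_ m gamma).
Local Notation delta := (dagger m gamma).
Local Notation H := (H_ m gamma sigma tau).
Local Notation E := (dE x).
Local Notation v := (dv x).

Lemma tau_order_gt0 : (0 < m)%N.
Proof. exact: leq_ltn_trans (leq0n gamma) (ltn_ord gamma). Qed.

Lemma index_gt0 : (0 < g)%N.
Proof. by rewrite gcdn_gt0 tau_order_gt0 orbT. Qed.

Lemma m_mul_index : (mu * g = m)%N.
Proof. by rewrite /m_ divnK ?dvdn_gcdr. Qed.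

Lemma m_gamma_gt0 : (0 < mu)%N.
Proof. by rewrite lt0n; apply: contraTneq tau_order_gt0 => mu0; rewrite -m_mul_index mu0. Qed.

Lemma coprime_dagger : coprime delta mu.
Proof.
rewrite /coprime -(eqn_pmul2r index_gt0) mul1n muln_gcdl /dagger /m_.
by rewrite !divnK ?dvdn_gcdl ?dvdn_gcdr.
Qed.

Lemma zeta_prim : mu.-primitive_root (zeta mu).
Proof.
apply: hzeta.1; apply: contra hm => /dvdn_trans; apply.
by apply/dvdnP; exists g; rewrite mulnC m_mul_index.
Qed.

Lemma zeta_index : zeta m ^+ g = zeta mu.
Proof. by have := hzeta.2 mu g; rewrite m_mul_index; apply. Qed.

Section Torsor.
Variables (A : gT -> {lrmorphism L -> L}) (B : gT -> {lrmorphism E -> E}).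
Hypothesis AE : forall h y, A h y = actL h y.
Hypothesis BE : forall h, h \in H -> forall y, B h y = dact x h y.
Variable i0 : 'I_g.
Hypothesis phi_equiv : forall h y, h \in H ->
  dphi x i0 (A h y) = B h (dphi x i0 y).

Lemma torsor_act1 y : A 1%g y = y.
Proof. by rewrite AE; case: hL.1 => _ -> _. Qed.

Lemma torsor_actM h h' y : A (h * h')%g y = A h (A h' y).
Proof. by rewrite !AE; case: hL.1 => _ _ ->; rewrite ?inE. Qed.

(* In these coordinates, unlike those given by [dphi], the components of an
   eigenvector of tau are scalar multiples of each other. *)
Definition psi (n : 'I_g) : {lrmorphism L -> E} := dphi x i0 \o A (tau ^+ n)%g.

Arguments psi : simpl never.

Lemma psiZ n c y : psi n (c *: y) = c *: psi n y.
Proof. exact: linearZ. Qed.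

Lemma psiE n y : psi n y = dphi x i0 (A (tau ^+ n)%g y).
Proof. by []. Qed.

Lemma phi_inj y : (forall i, dphi x i y = 0) -> y = 0.
Proof.
move=> y0; apply: (bij_inj (dphi_bij x)).
by apply/ffunP => i; rewrite !ffunE rmorph0.
Qed.

Lemma phi_surj (f : 'I_g -> E) : exists y, forall i, dphi x i y = f i.
Proof.
case: (dphi_bij x) => inv _ fK; exists (inv [ffun i => f i]) => i.
by have /ffunP/(_ i) := fK [ffun i => f i]; rewrite !ffunE.
Qed.

(* L (x) L = Map(G, L), projected to the component i0 of the left factor, shows
   that y is determined by the i0-components of all its conjugates. *)
Lemma conjugates_inj y : (forall h, dphi x i0 (A h y) = 0) -> y = 0.
Proof.
move=> y0; have [eps epsP] := phi_surj (fun i => (i == i0)%:R).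
have epsA h : eps * A h y = 0.
  apply: phi_inj => i; rewrite rmorphM /= epsP.
  by have [->|_] := eqVneq i i0; rewrite ?y0 ?mulr0 // mul0r.
have [_ [n [b [basis tensor]]]] := hL.
have [c [yE _]] := basis y.
have [c0 [_ uniq]] := tensor [ffun=> 0].
have z1 : c0 = [ffun=> 0].
  by apply: uniq => h; rewrite ffunE big1 // => i _; rewrite ffunE mul0r.
(* These are the coordinates of eps (x) y, whose image is the zero function by [epsA]. *)
have z2 : c0 = [ffun i => c i *: eps].
  apply: uniq => h; rewrite ffunE; transitivity (eps * A h y).
    by rewrite epsA.
  rewrite {1}yE linear_sum mulr_sumr.
  apply: eq_bigr => i _; rewrite ffunE /= linearZ /= -scalerAl -scalerAr.
  by rewrite AE.
have c_eps i : c i = 0.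
  have /ffunP/(_ i) : [ffun=> 0] = [ffun i => c i *: eps] by rewrite -z1.
  rewrite !ffunE => /(congr1 (dphi x i0)) /eqP.
  by rewrite linearZ rmorph0 /= epsP eqxx eq_sym scaler_eq0 oner_eq0 orbF => /eqP.
by rewrite yE big1 // => i _; rewrite c_eps scale0r.
Qed.

(** Every element of G is an element of H times tau^n with n < g, and on component [i0] the factor
    in H acts through E, so all conjugates of y vanish there. *)
Lemma psi_inj y : (forall n, psi n y = 0) -> y = 0.
Proof.
move=> y0; apply: conjugates_inj => h.
have [u [N ->]] := semidirect_elt hG h.
have -> : (sigma ^+ u * tau ^+ N =
   (sigma ^+ u * tau_ m gamma tau ^+ (N %/ g)) * tau ^+ (N %% g))%g.
  by rewrite /tau_ -expgM -mulgA -expgD [(g * _)%N]mulnC -divn_eq.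
rewrite torsor_actM phi_equiv; last first.
  apply: groupM; apply: groupX; [exact: sigma_in_H | exact: tau_in_H].
by rewrite -(psiE (Ordinal (ltn_pmod N index_gt0))) y0 rmorph0.
Qed.

(** Transported through [dphi], the map becomes an injective K-linear endomorphism of the
    finite-dimensional space E^g. *)
Lemma psi_surj (f : 'I_g -> E) : exists y, forall n, psi n y = f n.
Proof.
pose U := {ffun 'I_g -> E}.
have [inv invP] := choice (fun f : U => phi_surj f).
have invE (u w : L) : (forall i, dphi x i u = dphi x i w) -> u = w.
  move=> uw; apply/eqP; rewrite -subr_eq0; apply/eqP/phi_inj => i.
  by rewrite rmorphB /= uw subrr.
pose Theta (f : U) : U := [ffun n => psi n (inv f)].
have lin : linear Theta.
  move=> c u w; apply/ffunP => n; rewrite !ffunE -linearP; congr (psi n _).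
  by apply: invE => i; rewrite linearP /= !invP !ffunE.
pose lT := GRing.isLinear.Build _ _ _ _ Theta lin.
pose ThetaL : {linear U -> U} := HB.pack Theta lT.
have ker0 : lker (linfun ThetaL) == 0%VS.
  apply/lker0P => u w; rewrite !lfunE /= => /ffunP eqT.
  have eqi : inv u = inv w.
    apply/eqP; rewrite -subr_eq0; apply/eqP/psi_inj => n.
    rewrite rmorphB; apply/eqP; rewrite subr_eq0; apply/eqP.
    by have := eqT n; rewrite !ffunE.
  by apply/ffunP => i; rewrite -!invP eqi.
have : [ffun n => f n] \in limg (linfun ThetaL) by rewrite lker0_limgf ?memvf.
case/memv_imgP => u _ /ffunP fu; exists (inv u) => n.
by have := fu n; rewrite lfunE /= !ffunE.
Qed.

Local Notation r := (dr x).
Local Notation alpha := (dalpha x).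
Local Notation beta := (dbeta x).
Local Notation T := (B (tau_ m gamma tau)).
Local Notation om := (omega v p mu alpha beta).

Lemma ext_act1 y : B 1%g y = y.
Proof. by rewrite BE //; case: (dext x) => -[_ -> _]. Qed.

Lemma ext_actM h h' y : h \in H -> h' \in H -> B (h * h')%g y = B h (B h' y).
Proof.
by move=> hH hH'; rewrite !BE ?groupM //; case: (dext x) => -[_ _ ->].
Qed.

Lemma sigmaX_alpha N : B (sigma ^+ N)%g alpha = alpha.
Proof.
elim: N => [|N IH]; first by rewrite expg0 ext_act1.
rewrite expgS ext_actM ?groupX ?sigma_in_H // IH BE ?sigma_in_H //.
exact: dsigma_alpha.
Qed.

Lemma sigmaX_beta N : B (sigma ^+ N)%g beta = beta + N%:R.
Proof.
elim: N => [|N IH]; first by rewrite expg0 ext_act1 addr0.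
rewrite expgS ext_actM ?groupX ?sigma_in_H // IH rmorphD rmorph_nat /=.
by rewrite BE ?sigma_in_H // dsigma_beta -addrA -mulrS.
Qed.

Lemma datum_artin_schreier :
  artin_schreier v p mu delta (zeta mu) r (B sigma) T alpha beta.
Proof.
have [sH tH] := (sigma_in_H m sigma tau gamma, tau_in_H m sigma tau gamma).
split.
- exact: dvP.
- exact: hp.
- exact: m_gamma_gt0.
- exact: coprime_dagger.
- exact: zeta_prim.
- exact: dalpha_root.
- exact: dbeta_AS.
- exact: dgen.
- by rewrite BE // dsigma_alpha.
- by rewrite BE // dsigma_beta.
- by rewrite BE // dtau_alpha.
- by rewrite BE // dtau_beta.
- exact: dv_beta.
- case: (drP x) => pi [pi0 vpi spi jump].
  by exists pi; rewrite !BE.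
Qed.

Let ext := datum_artin_schreier.
Let hv := dvP x.

(** Moving sigma to the left of tau^n raises it to the power a^n, which lies in H and hence acts on
    E. *)
Lemma psi_sigma n y : psi n (A sigma y) = B (sigma ^+ (a ^ n))%g (psi n y).
Proof.
rewrite !psiE -torsor_actM (tauX_sigma hG) torsor_actM phi_equiv //.
by rewrite groupX ?sigma_in_H.
Qed.

Lemma psi_difference n l y :
  psi n (iter l (difference (A sigma)) y)
  = iter l (difference (B (sigma ^+ (a ^ n))%g)) (psi n y).
Proof.
apply: difference_iter_morph => [u w|u]; first exact: rmorphB.
exact: psi_sigma.
Qed.

Lemma phi_difference l y :
  dphi x i0 (iter l (difference (A sigma)) y)
  = iter l (difference (B sigma)) (dphi x i0 y).
Proof.
apply: difference_iter_morph => [u w|u]; first exact: rmorphB.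
by apply: phi_equiv; apply: sigma_in_H.
Qed.

Lemma integers_difference l y :
  integers y -> integers (iter l (difference (A sigma)) y).
Proof.
move=> iy; elim: l => //= l IH.
by apply: integersB => //; apply: integers_rmorph.
Qed.

(** Multiplying by delta or by its inverse modulo m_gamma identifies the congruence of the formula
    with the eigenvalue condition of tau_gamma on omega_ij. *)
Lemma mem_index_set (i : 'I_mu) (j : 'I_d) :
  ((i, j) \in index_set m gamma d r s)
  = (delta%:Z * (i%:Z - r * j%:Z) == s%:Z %[mod mu])%Z.
Proof.
rewrite inE /=; set X := i%:Z - r * j%:Z; set u := inv_mod delta mu.
have /eqP du : (delta * u == 1 %[mod mu])%N by apply/eqP/inv_modP/coprime_dagger.
have duz : (mu%:Z %| delta%:Z * u%:Z - 1)%Z.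
  by rewrite -PoszM -eqz_mod_dvd !modz_nat du.
rewrite !eqz_mod_dvd; apply/idP/idP => dv.
  have -> : delta%:Z * X - s%:Z =
      delta%:Z * (X - (s * u)%N%:Z) + s%:Z * (delta%:Z * u%:Z - 1).
    by rewrite PoszM; ring.
  by rewrite rpredD // dvdz_mull.
have -> : X - (s * u)%N%:Z =
    u%:Z * (delta%:Z * X - s%:Z) - X * (delta%:Z * u%:Z - 1).
  by rewrite PoszM; ring.
by rewrite rpredB // dvdz_mull.
Qed.

Lemma index_row : exists row : 'I_d -> 'I_mu, forall i j,
  ((i, j) \in index_set m gamma d r s) = (i == row j).
Proof.
have mu0 := m_gamma_gt0; pose c := (s * inv_mod delta mu)%N%:Z.
have rowlt (j : 'I_d) : (`|((c + r * j%:Z) %% mu)%Z| < mu)%N.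
  by rewrite -ltz_nat gez0_abs ?modz_ge0 ?ltz_pmod // gt_eqF.
exists (fun j => Ordinal (rowlt j)) => i j; rewrite inE /= -/c.
have ge0 : 0 <= ((c + r * j%:Z) %% mu)%Z by rewrite modz_ge0 // gt_eqF.
rewrite -val_eqE /= -eqz_nat gez0_abs //.
have -> : (i%:Z == ((c + r * j%:Z) %% mu)%Z) = (i%:Z == c + r * j%:Z %[mod mu])%Z.
  by rewrite [(i%:Z %% _)%Z]modz_small // ltz_nat ltn_ord.
by rewrite !eqz_mod_dvd opprD addrA addrAC.
Qed.

(** * Generators of Xi *)

Section Rows.
Variable row : 'I_d -> 'I_mu.
Hypothesis rowP : forall i j,
  ((i, j) \in index_set m gamma d r s) = (i == row j).

Let w (j : 'I_d) : E := om (row j) j.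

Lemma row_cond (j : 'I_d) :
  (delta%:Z * ((row j)%:Z - r * j%:Z) == s%:Z %[mod mu])%Z.
Proof. by rewrite -mem_index_set rowP. Qed.

Lemma T_w j : T (w j) = constK (zeta mu ^+ s) *: w j.
Proof.
rewrite (T_omega ext); congr (constK _ *: _); apply/eqP.
by rewrite (prim_exp_cond ext) row_cond.
Qed.

(** Lift of [w j] to L. Its other components are forced by the eigenvalue zeta_m^s of tau, because
    [psi n] is component 0 composed with tau^n. *)
Variable wt : 'I_d -> L.
Hypothesis wtP : forall j n, psi n (wt j) = constK (zeta m ^+ (s * n)) *: w j.

Let z_neq0 n : zeta m ^+ n != 0.
Proof.
rewrite expf_neq0 //; apply/eqP => z0.
have := prim_expr_order (hzeta.1 m hm); rewrite z0 expr0n gtn_eqF ?tau_order_gt0 //.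
by move/eqP; rewrite eq_sym oner_eq0.
Qed.

(** Composing [psi n] with tau gives the next component, which fits the weights zeta_m^(s n). After
    the last one, tau^g = tau_gamma acts on [w j] by zeta_mu^s = zeta_m^(s g), so the weights close
    up. *)
Lemma tau_wt j : A tau (wt j) = constK (zeta m ^+ s) *: wt j.
Proof.
apply: (psi_eq psi_inj) => n; rewrite psiZ wtP scalerA -rmorphM /=.
rewrite -torsor_actM -expgSr -exprD -mulnS.
have [lt|ge] := ltnP n.+1 g.
  by rewrite -(psiE (Ordinal lt)) wtP.
have gE : n.+1 = g by apply/eqP; rewrite eqn_leq ge ltn_ord.
have phiw : dphi x i0 (wt j) = w j.
  have := wtP j (Ordinal index_gt0).
  by rewrite psiE /= expg0 torsor_act1 muln0 expr0 rmorph1 scale1r.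
rewrite gE -[(tau ^+ g)%g]/(tau_ m gamma tau) phi_equiv ?tau_in_H // phiw T_w.
by rewrite -zeta_index -exprM mulnC.
Qed.

Definition generator (j : 'I_d) : 'rV[L]_d :=
  \row_l iter l (difference (A sigma)) (wt j).

Lemma psi_generator j l n :
  psi n (iter l (difference (A sigma)) (wt j)) =
  constK (zeta m ^+ (s * n)) *: iter l (difference (B (sigma ^+ (a ^ n))%g)) (w j).
Proof.
rewrite psi_difference wtP -[_ *: w j]mulr_algl -[RHS]mulr_algl difference_iterM //.
by rewrite /= linearZ /= rmorph1.
Qed.

Lemma psi_generator_diag j n :
  psi n (generator j 0 j) = (constK (zeta m ^+ (s * n)) *
    (tK k ^ omega_exp v p mu alpha beta (row j) j * ((a ^ n) ^ j * j`!)%:R))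
     *: alpha ^+ row j.
Proof.
rewrite mxE psi_generator -scalerA; congr (_ *: _).
by have [] := @difference_omega _ _ v p mu alpha beta _ (a ^ n) (row j) j
  (sigmaX_alpha _) (sigmaX_beta _).
Qed.

Lemma generator_tri (j : 'I_d) (l : nat) :
  (j < l)%N -> iter l (difference (A sigma)) (wt j) = 0.
Proof.
move=> jl; apply: psi_inj => n; rewrite psi_generator.
have [_ ->] := @difference_omega _ _ v p mu alpha beta _ (a ^ n) (row j) j
  (sigmaX_alpha _) (sigmaX_beta _); [by rewrite scaler0 | exact: jl].
Qed.

Lemma integers_generator j l : integers (generator j 0 l).
Proof.
rewrite mxE; apply: integers_difference.
apply/(integers_components hv psi_inj) => n; rewrite wtP.
by apply/(integersE hv)/integers_constZ/(integers_omega ext).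
Qed.

(** The j-fold difference uses up beta^j, so only t^n_ij alpha^i contributes; the jump r enters the
    length through the ceiling and the index set alone. *)
Definition diag_val (j : 'I_d) : int :=
  omega_exp v p mu alpha beta (row j) j * (mu * p)%N%:Z + (row j)%:Z * p%:Z.

Lemma dalpha_neq0 : alpha != 0.
Proof.
have := tE_neq0 E; rewrite -(as_root ext); apply: contraNneq => ->.
by rewrite expr0n gtn_eqF ?m_gamma_gt0.
Qed.

(** The integer (a^n)^j j! is prime to p: p does not divide a, and j < d <= p. *)
Lemma generator_diag_neq0 j n : psi n (generator j 0 j) != 0.
Proof.
have pK : p \in [pchar laurent k] := pchar_laurent (laurent k)^o hp.
have pp : prime p by apply: pcharf_prime hp.
rewrite psi_generator_diag scaler_eq0 negb_or expf_neq0 ?dalpha_neq0 // andbT.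
rewrite !mulf_neq0 ?fmorph_eq0 ?expfz_neq0 ?tK_neq0 //.
rewrite -(dvdn_pcharf pK) Euclid_dvdM // negb_or prime_ndvd_fact //; last first.
  exact: leq_trans (ltn_ord j) le_dp.
rewrite andbT -expnM; apply: contra (semidirect_prime_ndvd hG pp).
by rewrite Euclid_dvdX // => /andP[].
Qed.

Lemma generator_diag_val j n : v (psi n (generator j 0 j)) = diag_val j.
Proof.
have := generator_diag_neq0 j n; rewrite psi_generator_diag.
set c1 := constK _; set c2 := _%:R; set t := tK k ^ _.
rewrite scaler_eq0 !mulf_eq0 !negb_or => /andP[/and3P[c10 _ c20] al0].
have c2E : c2 = constK ((a ^ n) ^ j * j`!)%:R by rewrite rmorph_nat.
have c2k : ((a ^ n) ^ j * j`!)%:R != 0 :> k.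
  by move: c20; rewrite c2E fmorph_eq0.
have -> : (c1 * (t * c2)) *: alpha ^+ row j =
    (constK (zeta m ^+ (s * n) * ((a ^ n) ^ j * j`!)%:R))%:A * (t *: alpha ^+ row j).
  rewrite rmorphM /= -c2E mulr_algl scalerA; congr (_ *: _).
  by rewrite -mulrA [t * _]mulrC.
have ta0 : t *: alpha ^+ row j != 0.
  by rewrite scaler_eq0 negb_or expfz_neq0 ?tK_neq0.
rewrite (valuM hv) ?const_neq0 ?mulf_neq0 // (val_const hv) ?mulf_neq0 // add0r.
rewrite (val_scale_t ext) // (valuX hv) ?dalpha_neq0 //.
by rewrite (val_alpha ext).
Qed.

Lemma diag_val_ge0 j : 0 <= diag_val j.
Proof.
have n : 'I_g := Ordinal index_gt0.
rewrite -(generator_diag_val j n).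
have /(integersE hv)/(vgeP _ _ (generator_diag_neq0 j n)) // :=
  integers_rmorph (psi n) (integers_generator j j).
Qed.

Lemma generator_equivariant j h : equivariant V A (generator j) h.
Proof.
have es : equivariant V A (generator j) sigma.
  apply/(equivariant_sigma hV torsor_act1) => l; rewrite mxE -iterS.
  have [lt|ge] := ltnP l.+1 d.
    by rewrite (entryE _ (Ordinal lt)) mxE.
  (* At the last coordinate the entry l + 1 = d is 0 by convention, and the difference of order d
     vanishes because j < d. *)
  rewrite generator_tri; last exact: leq_trans (ltn_ord j) ge.
  rewrite /entry big_pred0 // => i; apply/negbTE/eqP => il.
  by have := ltn_ord i; rewrite il ltnNge ge.
apply: (equivariant_all hG torsor_act1 torsor_actM es).
apply: (equivariant_tau hG hV torsor_act1 torsor_actM (j0 := Ordinal d_gt0) _ es) => //.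
by rewrite !mxE /= tau_wt.
Qed.

Lemma Xi_generator j : Xi V actL (generator j).
Proof.
split=> [l|h l]; first exact: integers_generator.
by rewrite -AE; apply: generator_equivariant.
Qed.

Lemma entry_difference (c : 'rV[L]_d) n : equivariant V A c sigma -> (n <= d)%N ->
  entry c n = iter n (difference (A sigma)) (entry c 0).
Proof.
move=> /(equivariant_sigma hV torsor_act1) es; elim: n => // n IH ltnd.
by rewrite iterS -(IH (ltnW ltnd)) -(es (Ordinal ltnd)) -entryE.
Qed.

(** The first coordinate satisfies the hypotheses of [invariant_expansion] on component [i0]. The
    coefficients found there serve every component, since tau scales y and each [wt j] by the same
    zeta_m^s. *)
Lemma Xi_expansion (c : 'rV[L]_d) : Xi V actL c ->
  exists f : 'I_d -> fps k, c = \sum_j fps_in L (f j) *: generator j.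
Proof.
case=> ic eqc; pose j0 := Ordinal d_gt0; pose y := c 0 j0.
have j00 : j0 = 0%N :> nat by [].
have es : equivariant V A c sigma by move=> j; rewrite AE eqc.
have cE (l : 'I_d) : c 0 l = iter l (difference (A sigma)) y.
  by rewrite -entryE (entry_difference es (ltnW (ltn_ord l))) /y -(entryE c j0).
have Dy : iter d (difference (A sigma)) y = 0.
  rewrite /y -(entryE c j0) -(entry_difference es (leqnn d)) /entry big_pred0 //.
  by move=> i; rewrite ltn_eqF.
have ty : A tau y = constK (zeta m ^+ s) *: y.
  rewrite AE eqc (bigD1 j0) //= (hV.2 _ _ j00) eqxx mulr1n.
  rewrite big1 ?addr0 // => i ij.
  by rewrite (hV.2 _ _ j00) (negPf ij) mulr0n rmorph0 scale0r.
have tyn n : A (tau ^+ n)%g y = constK (zeta m ^+ (s * n)) *: y.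
  elim: n => [|n IH]; first by rewrite expg0 torsor_act1 muln0 expr0 rmorph1 scale1r.
  by rewrite expgSr torsor_actM ty linearZ /= IH scalerA -rmorphM -exprD mulnS.
have [|||| f fE] := invariant_expansion ext (s := s) (row := row) _
    (x := dphi x i0 y).
- by move=> i j; rewrite -mem_index_set rowP => /eqP.
- by apply/(integersE hv)/integers_rmorph/ic.
- rewrite -phi_equiv ?tau_in_H // /tau_ tyn linearZ /=.
  by rewrite mulnC exprM zeta_index.
- by rewrite -phi_difference Dy rmorph0.
have yE : y = \sum_j fps_in L (f j) * wt j.
  apply: (psi_eq psi_inj) => n.
  have -> : psi n y = constK (zeta m ^+ (s * n)) *: dphi x i0 y.
    by rewrite psiE tyn linearZ.
  have -> : psi n (\sum_j fps_in L (f j) * wt j) = \sum_j psi n (fps_in L (f j) * wt j).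
    exact: rmorph_sum.
  rewrite fE scaler_sumr; apply: eq_bigr => j _.
  by rewrite psi_fps wtP scalerAr.
exists f; apply/matrix.rowP => l; rewrite cE yE difference_iter_sum summxE.
apply: eq_bigr => j _; rewrite !mxE difference_iterM //.
by rewrite /= /fps_in linearZ /= rmorph1.
Qed.

Lemma Xi_span : integer_span (Xi V actL) = integral_span generator.
Proof.
apply/funext => c; apply/propext; split; last first.
  by case=> b [ib ->]; exists d, b, generator; split=> // j; split;
    [exact: ib | exact: Xi_generator].
case=> n [b [y [by_ ->]]].
have [f fE] := choice (fun i => Xi_expansion (by_ i).2).
exists (fun j => \sum_i b i * fps_in L (f i j)); split=> [j|].
  apply: integers_sum => i _; apply: integersM; first by case: (by_ i).
  exact: integers_fps.
under [RHS]eq_bigr do rewrite scaler_suml.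
rewrite exchange_big; apply: eq_bigr => i _ /=; rewrite fE scaler_sumr.
by apply: eq_bigr => j _; rewrite scalerA.
Qed.

Lemma datum_quotient_length :
  quotient_length (fun (f : fps k) (c : 'rV[L]_d) => fps_in L f *: c)
    (@integer_vectors k d L) (integer_span (Xi V actL)) =
  Some (\sum_j g * `|diag_val j|)%N.
Proof.
rewrite Xi_span; apply: quotient_length_comp => [f c|].
  by rewrite rmorphN scaleNr.
apply: (triangular_length hv psi_inj psi_surj) => [j l|j l jl|j n|j n].
- exact: integers_generator.
- by rewrite mxE generator_tri.
- exact: generator_diag_neq0.
- by rewrite generator_diag_val gez0_abs ?diag_val_ge0.
Qed.

End Rows.
End Torsor.
End Datum.

(** * Trivial torsors *)

Section TrivialTorsor.
Variables (k : fieldType) (gT : finGroupType) (d : nat).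
Variable V : mx_representation k [set: gT]%G d.
Variables (L : comAlgType (laurent k)) (actL : gT -> L -> L).
Variable phi : gT -> {lrmorphism L -> (laurent k)^o}.
Hypothesis phi_bij :
  bijective (fun x : L => [ffun g => phi g x] : {ffun gT -> (laurent k)^o}).
Hypothesis phi_act : forall g h x, phi g (actL h x) = phi (g * h)%g x.

Lemma trivial_eq x y : (forall g, phi g x = phi g y) -> x = y.
Proof.
move=> xy; apply: (bij_inj phi_bij); apply/ffunP => g.
by rewrite !ffunE.
Qed.

Lemma trivial_lift (f : gT -> laurent k) : exists x, forall g, phi g x = f g.
Proof.
case: phi_bij => inv _ fK; exists (inv [ffun g => f g]) => g.
by have /ffunP/(_ g) := fK [ffun g => f g]; rewrite !ffunE.
Qed.

Lemma trivial_scal g (c : laurent k) : phi g (c%:A) = c.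
Proof. by rewrite linearZ rmorph1 /= /GRing.scale /= mulr1. Qed.

(** The product over G of the factors X - u g is a monic equation for x. *)
Lemma trivial_integers (u : gT -> k) x :
  (forall g, phi g x = constK (u g)) -> integers x.
Proof.
move=> xu; exists (\prod_g ('X - (fpsC (u g))%:P)).
  by apply: monic_prod => g _; apply: monicXsubC.
apply/rootP; rewrite rmorph_prod horner_prod /=; apply: trivial_eq => g.
rewrite rmorph_prod rmorph0 (bigD1 g) //=.
rewrite map_polyXsubC hornerXsubC rmorphB /= xu trivial_scal.
by rewrite subrr mul0r.
Qed.

(** The functions g |-> V g i j on G are integral and their rows lie in Xi. The functions given by V
    g^-1 are integral too, so these rows generate all integer vectors. *)
Theorem trivial_quotient_length :
  quotient_length (fun (f : fps k) (c : 'rV[L]_d) => fps_in L f *: c)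
    (@integer_vectors k d L) (integer_span (Xi V actL)) = Some 0%N.
Proof.
suff -> : integer_span (Xi V actL) = @integer_vectors k d L.
  apply: quotient_length_comp => [f c|]; first by rewrite rmorphN scaleNr.
  apply: comp_length0; split=> [j|x y ix iy j|f x ix j]; rewrite mxE.
  - exact: integers0.
  - by apply: integersD; [apply: ix | apply: iy].
  - by apply: integersM; [apply: integers_fps | apply: ix].
have lift2 (F : gT -> 'M[k]_d) : exists y : 'I_d -> 'I_d -> L,
    forall i j g, phi g (y i j) = constK (F g i j).
  have [y yP] := choice (fun ij : 'I_d * 'I_d =>
    trivial_lift (fun g => constK (F g ij.1 ij.2))).
  by exists (fun i j => y (i, j)) => i j g; rewrite yP.
have [y yP] := lift2 (fun g => V g).
have [w wP] := lift2 (fun g => V g^-1%g).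
pose Y i : 'rV[L]_d := \row_j y i j.
have iy i j : integers (y i j) by apply: trivial_integers => g; apply: yP.
have iw i j : integers (w i j) by apply: trivial_integers => g; apply: wP.
have phiZ g c x : phi g (c *: x) = c * phi g x by rewrite linearZ.
have XiY i : Xi V actL (Y i).
  split=> [j|h j]; first by rewrite mxE.
  apply: trivial_eq => g; rewrite phi_act mxE yP repr_mxM ?inE // mxE.
  rewrite !rmorph_sum; apply: eq_bigr => l _ /=.
  by rewrite phiZ mxE yP rmorphM mulrC.
apply/funext => c; apply/propext; split.
  case=> n [a [z [az ->]]] j; rewrite summxE; apply: integers_sum => i _.
  by rewrite mxE; apply: integersM; [case: (az i) | case: (az i) => _ []].
(* The coefficients are those of c = (c V^-1) V, read in each component. *)
move=> ic; exists d, (fun i => \sum_j c 0 j * w j i), Y; split=> [i|].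
  split=> //; apply: integers_sum => j _; exact: integersM.
apply/rowP => l; apply: trivial_eq => g; rewrite summxE rmorph_sum /=.
transitivity (\sum_j phi g (c 0 j) * constK ((V g^-1%g *m V g) j l)).
  rewrite -repr_mxM ?inE // mulVg repr_mx1 (bigD1 l) //= mxE eqxx rmorph1 mulr1.
  by rewrite big1 ?addr0 // => j jl; rewrite mxE (negPf jl) rmorph0 mulr0.
under [RHS]eq_bigr do rewrite !mxE rmorphM rmorph_sum mulr_suml /=.
rewrite exchange_big; apply: eq_bigr => j _ /=.
rewrite mxE rmorph_sum mulr_sumr; apply: eq_bigr => i _ /=.
by rewrite !rmorphM /= wP yP mulrA.
Qed.

End TrivialTorsor.

Lemma sum_index_set (m gamma d s : nat) (r : int) (R : nmodType)
    (row : 'I_d -> 'I_(m_ m gamma)) (F : 'I_(m_ m gamma) * 'I_d -> R) :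
    (forall i j, ((i, j) \in index_set m gamma d r s) = (i == row j)) ->
  \sum_(ij in index_set m gamma d r s) F ij = \sum_j F (row j, j).
Proof.
move=> rowP; rewrite (reindex_onto (fun j => (row j, j)) snd) /=.
  by apply: eq_bigl => j; rewrite rowP !eqxx.
by case=> i j; rewrite rowP /= => /eqP ->.
Qed.

Lemma length_term (N : int) (i g mu p : nat) :
    (0 < g)%N -> (0 < mu)%N -> (0 < p)%N ->
    0 <= N * (mu * p)%N%:Z + i%:Z * p%:Z ->
  (g * `|N * (mu * p)%N%:Z + i%:Z * p%:Z|)%:R / (p * (mu * g))%:R
  = i%:R / mu%:R + N%:~R :> rat.
Proof.
move=> g0 mu0 p0 ge0; rewrite !natrM natr_absz ger0_norm //.
rewrite rmorphD !rmorphM /=.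
have gn : g%:R != 0 :> rat by rewrite pnatr_eq0 -lt0n.
have mn : mu%:R != 0 :> rat by rewrite pnatr_eq0 -lt0n.
have pn : p%:R != 0 :> rat by rewrite pnatr_eq0 -lt0n.
rewrite -!pmulrn; field; rewrite gn mn pn //.
Qed.

Lemma integral_term (N : int) (i mu p h : nat) :
  (0 < mu)%N -> (mu * p %| h)%N -> h%:R * (i%:R / mu%:R + N%:~R) \is a @Num.int rat.
Proof.
move=> mu0 /dvdnP [c ->].
have mn : mu%:R != 0 :> rat by rewrite pnatr_eq0 -lt0n.
have -> : (c * (mu * p))%:R * (i%:R / mu%:R + N%:~R) =
   ((c * p)%N%:Z * (i%:Z + N * mu%:Z))%:~R :> rat.
  rewrite !rmorphM /= rmorphD /= rmorphM /= -!pmulrn; field.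
  exact: mn.
exact: intr_int.
Qed.

Theorem proposition4p9
    (k : closedFieldType) (p : nat) (hp : p \in [pchar k])
    (zeta : nat -> k) (hzeta : is_root_system p zeta)
    (m : nat) (hm : ~~ (p %| m)%N)
    (gT : finGroupType) (sigma tau : gT) (a : nat)
    (hG : is_semidirect_group p m a sigma tau)
    (gamma s : 'I_m) (d : nat) (hd : (1 <= d <= p)%N)
    (V : mx_representation k [set: gT]%G d) (hV : is_V m zeta sigma tau s V)
    (L : comAlgType (laurent k)) (actL : gT -> L -> L)
    (hL : is_Getale actL) :
  (is_trivial_torsor actL -> v_function V actL = Some 0) /\
  (forall x : Delta_datum p zeta m sigma tau gamma actL,
     let q := v_formula p m gamma d s (dr x) (dv x (dalpha x)) (dv x (dbeta x))
     in v_function V actL = Some q /\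
        #|H_ m gamma sigma tau|%:R * q \is a Num.int).
Proof.
have pp : prime p := pcharf_prime hp; have p0 := prime_gt0 pp.
have /andP[d_gt0 le_dp] := hd.
split=> [[phi [phi_bij phi_act]]|x q].
  rewrite /v_function (trivial_quotient_length V phi_bij phi_act) /=.
  by rewrite mul0r.
have [A AE'] := alg_action_lrmorphism hL.1.
have AE h y : A h y = actL h y by rewrite AE' ?inE.
have [B BE] := alg_action_lrmorphism (let: And3 act _ _ := dext x in act).
have [i0 phi_equiv'] := dphi_equiv x.
have phi_equiv h y : h \in H_ m gamma sigma tau ->
    dphi x i0 (A h y) = B h (dphi x i0 y).
  by move=> hH; rewrite AE phi_equiv' // BE.
have [row row_spec] := @index_row _ _ _ _ _ _ _ gamma s d L actL x.
pose wE j := omega (dv x) p (m_ m gamma) (dalpha x) (dbeta x) (row j) j.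
have psi_lift := psi_surj hG hL AE phi_equiv.
have [wt wtP] := choice (fun j : 'I_d => psi_lift
  (fun n => constK (zeta m ^+ (s * n)) *: wE j)).
have len := datum_quotient_length hp hzeta hm hG d_gt0 le_dp hV hL AE BE
  phi_equiv row_spec wtP.
have mu0 := m_gamma_gt0 gamma; have g0 := index_gt0 gamma.
have qE : q = \sum_j ((row j)%:R / (m_ m gamma)%:R +
    (omega_exp (dv x) p (m_ m gamma) (dalpha x) (dbeta x) (row j) j)%:~R).
  rewrite /q /v_formula !(sum_index_set _ row_spec) rmorph_sum -big_split.
  by apply: eq_bigr.
have Dge0 := diag_val_ge0 hp hzeta hm hG le_dp hL AE BE phi_equiv wtP.
split.
  rewrite /v_function len /=; congr Some; rewrite qE (semidirect_card hG).
  rewrite natr_sum mulr_suml; apply: eq_bigr => j _.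
  rewrite -[X in (p * X)%N](m_mul_index gamma).
  exact: length_term (Dge0 j).
rewrite qE mulr_sumr rpred_sum // => j _.
exact: (integral_term _ _ mu0 (H_card_dvd hG gamma pp hm)).
Qed.
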